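(* Let $T$ be an oriented 2-tangle diagram, $k\in\{0,1\}$, and suppose the orientation of $T$ extends to an orientation of the closure $[T,k]$. Let $(K_{T,k},\partial_T)$ be the complex defined in the context. Then $\partial_T$ squares to zero, has bidegree $(1,1)$, and in fact $\partial_T$ consists only of the terms $\phi\otimes\mu^2(u,y)$ (all terms involving $\mu^3$ vanish). Moreover there is a chain isomorphism from $(K_{T,k},\partial_T)$ to the reduced Khovanov complex $C\mathrm{Kh}^{\mathrm{red}}([T,k])$ (reduced at the component containing $1$) carrying bidegree $(r,s)$ to Khovanov bidegree $(q,h)=(r-s,s)$. Consequently $H^{r,s}(K_{T,k},\partial_T)\cong\mathrm{Kh}^{\mathrm{red}}([T,k])^{r-s,s}$.
   Context: Work over $\mathbb F=\mathbb F_2$. Pillowcase. $P$ is the quotient of $\mathbb R^2$ by the group generated by $(\gamma,\theta)\mapsto(\gamma+2\pi,\theta)$, $(\gamma,\theta)\mapsto(\gamma,\theta+2\pi)$, $(\gamma,\theta)\mapsto(-\gamma,-\theta)$; $[\gamma,\theta]$ denotes the image of $(\gamma,\theta)$; $P^*$ is the complement of the four images of $(\pi\mathbb Z)^2$. For a small fixed $\delta>0$: $L_0(t)=[\tfrac\pi2+t+\delta\sin t,\tfrac\pi2+t-\delta\sin t]$, $L_1(t)=[\pi-2\delta\sin t,\tfrac\pi2-t-\delta\sin t]$ ($t\in\mathbb R/2\pi\mathbb Z$), and arcs $W_0(t)=[t,t]$, $W_1(t)=[\pi,-t]$ ($t\in[0,\pi]$). $C'$ denotes the image of a curve $C$ under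 the time-$s$ flow, $s>0$ small, of the Hamiltonian vector field of $f(\gamma,\theta)=-\cos\gamma\cos(\theta-\gamma)$ (further pushoffs $C^{(k)}$ at successively larger small times). For objects $X,Y$ among these curves, $(X,Y)$ is the $\mathbb F$-span of $X'\cap Y$. Polygon-counting maps: for $W\in\{W_0,W_1\}$, $C_1,\dots,C_n\in\{L_0,L_1\}$, $y\in(W,C_1)$ and $x_\ell\in(C_\ell,C_{\ell+1})$, $\mu^n(x_{n-1},\dots,x_1,y)\in(W,C_n)$ counts (mod 2) equivalence classes of orientation-preserving immersions into $P^*$ of a convex $(n+1)$-gon with counterclockwise vertices $v_0,\dots,v_n$ whose first edge lies on the pushoff of $W$, the following edges on successive pushoffs of $C_1,\dots,C_n$, with inputs at $v_1,\dots,v_n$, output $\iota(v_0)$. Labels and gradings. Intersection points are labelled $L_0'\cap L_0\ni a_0,c_0$, $L_1'\cap L_1\ni a_1,c_1$, $L_1'\cap L_0\ni p_{01}$, $L_0'\cap L_1\ni q_{10}$, $W_0'\cap L_0=\{\alpha,\beta\}$, $W_0'\cap L_1=\{\gamma\}$, $W_1'\cap L_0=\{\tau\}$, $W_1'\cap L_1=\{\rho,\sigma\}$, so that the only nonzero maps $\mu^n$ with module input are: $\mu^2(a_0,\alpha)=\alpha,\mu^2(a_0,\beta)=\beta,\mu^2(c_0,\alpha)=\beta,\mu^2(a_1,\gamma)=\gamma,\mu^2(q_{10},\alpha)=\gamma,\mu^2(p_{01},\gamma)=\beta$, $\mu^2(a_1,\rho)=\rho,\mu^2(a_1,\sigma)=\sigma,\mu^2(c_1,\rho)=\sigma,\mu^2(a_0,\tau)=\tau,\mu^2(q_{10},\tau)=\sigma,\mu^2(p_{01},\rho)=\tau$,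 and $\mu^3(b_0,p_{01},\gamma)=\alpha$, $\mu^3(q_{01},q_{10},\alpha)=\alpha$, $\mu^3(c_0,b_0,\beta)=\beta$, $\mu^3(p_{01},p_{10},\alpha)=\alpha$, $\mu^3(b_1,q_{10},\tau)=\rho$, $\mu^3(q_{10},q_{01},\sigma)=\sigma$, $\mu^3(c_1,b_1,\sigma)=\sigma$, $\mu^3(p_{10},p_{01},\rho)=\rho$, $\mu^3(p_{01},p_{10},\tau)=\tau$ (where $b_i,p_{10},q_{01}$ are the remaining intersection points of the respective hom spaces). Gradings: $p(\alpha)=0,p(\beta)=-2,p(\gamma)=-1,p(\tau)=-1,p(\rho)=0,p(\sigma)=-2$; $A=\mathbb F[x]/(x^2)$ with $p(1)=1$, $p(x)=-1$. Tangles and cube. $B=\{1,i,-1,-i\}\subset\partial D^2$; planar 2-tangles are compact properly embedded 1-manifolds in $D^2$ with boundary $B$; the earringed arc is the one containing $1$. $T_0$: arcs joining $1$ to $-i$ and $i$ to $-1$; $T_1$: arcs joining $1$ to $i$ and $-1$ to $-i$; type $T_\ell(m)$ means $m$ circles plus arcs isotopic to those of $T_\ell$. A 2-tangle diagram has $n=n^++n^-$ crossings, ordered; for $i\in I=\{0,1\}^n$, $P_i$ is the complete resolution (entry 0: turn left when arriving along the overstrand; entry 1: the other), of type $T_{\ell_i}(m_i)$; $h(i)=-n^-+\#\{\text{ones in }i\}$. The closure $[T,k]$ is the link obtained by adjoining, outside $D^2$, the reflection of $T_k$ across $\partial D^2$ (so $[T_k,k]$ has two components). Maps: $\epsilon(x)=1,\epsilon(1)=0$;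 $\dot\epsilon(1)=1,\dot\epsilon(x)=0$; $\eta(1)=1$; $\dot\eta(1)=x$; $M$ multiplication on $A$; $S(1)=1\otimes x+x\otimes1$, $S(x)=x\otimes x$. When $j$ is obtained from $i$ by changing one $0$ to $1$, $\delta_{ji}\in\Hom(A^{\otimes m_i},A^{\otimes m_j})\otimes(L_{\ell_i},L_{\ell_j})$ is (identity on uninvolved circle factors) $\otimes$: $M\otimes a_\ell$ (two circles merge); $S\otimes a_\ell$ (circle splits); $\dot\epsilon\otimes a_\ell$ (circle merges into earringed arc); $\dot\eta\otimes a_\ell$ (circle splits off earringed arc); $\dot\epsilon\otimes a_\ell+\epsilon\otimes c_\ell$ (circle merges into unearringed arc); $\dot\eta\otimes a_\ell+\eta\otimes c_\ell$ (circle splits off unearringed arc); $\mathrm{id}\otimes q_{10}$ (saddle joining the two arcs, $\ell_i=0$); $\mathrm{id}\otimes p_{01}$ (saddle joining the two arcs, $\ell_i=1$). Otherwise $\delta_{ji}=0$. The complex. $K_{T,k}=\bigoplus_{i\in I}A^{\otimes m_i}\otimes(W_k,L_{\ell_i})$, where $v\otimes y$ in the $i$-summand has bidegree $(p(v)+p(y)+n^+-n^-+2h(i),\,h(i))$. The differential is $\partial_T(v\otimes y)=\sum_j\phi(v)\otimes\mu^2(u,y)+\sum_{j,j'}\phi'\phi(v)\otimes\mu^3(u',u,y)$, where $\delta_{ji}=\sum\phi\otimes u$ and $\delta_{j'j}=\sum\phi'\otimes u'$ (extended bilinearly). The reduced Khovanov complex uses the standard conventions: generators $A^{\otimes(\text{circles})}$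 with the factor of the circle through $1$ restricted to $\langle x\rangle$, $h=r-n^-$ and $q=\deg+r+n^+-2n^-$, where $r$ is the number of $1$-resolutions and $\deg$ sums $p(1)=1,p(x)=-1$. *)

(* Defs.v *)
From HB Require Import structures.
From mathcomp Require Import all_boot all_order all_algebra.
Set Implicit Arguments. Unset Strict Implicit. Unset Printing Implicit Defensive.
Import GRing.Theory.
Local Open Scope ring_scope.

Definition F := 'F_2.

Inductive Gen := g_alpha | g_beta | g_gamma | g_tau | g_rho | g_sigma.
Definition gen2o (g : Gen) : 'I_6 :=
  match g with g_alpha => @Ordinal 6 0 isT | g_beta => @Ordinal 6 1 isT
  | g_gamma => @Ordinal 6 2 isT | g_tau => @Ordinal 6 3 isT
  | g_rho => @Ordinal 6 4 isT | g_sigma => @Ordinal 6 5 isT end.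
Definition o2gen (i : 'I_6) : option Gen :=
  match val i with 0 => Some g_alpha | 1 => Some g_beta | 2 => Some g_gamma
  | 3 => Some g_tau | 4 => Some g_rho | 5 => Some g_sigma | _ => None end%N.
Lemma gen2oK : pcancel gen2o o2gen. Proof. by move=> g; case: g. Qed.
HB.instance Definition _ := Equality.copy Gen (pcan_type gen2oK).
HB.instance Definition _ := Countable.copy Gen (pcan_type gen2oK).
HB.instance Definition _ := Finite.copy Gen (pcan_type gen2oK).

Inductive LGen := l_a0 | l_b0 | l_c0 | l_a1 | l_b1 | l_c1
                | l_p01 | l_p10 | l_q01 | l_q10.
Definition lgens : seq LGen :=
  [:: l_a0; l_b0; l_c0; l_a1; l_b1; l_c1; l_p01; l_p10; l_q01; l_q10].
Definition lgen2n (u : LGen) : nat :=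
  match u with l_a0 => 0 | l_b0 => 1 | l_c0 => 2 | l_a1 => 3 | l_b1 => 4
  | l_c1 => 5 | l_p01 => 6 | l_p10 => 7 | l_q01 => 8 | l_q10 => 9 end%N.
Definition n2lgen (n : nat) : option LGen :=
  match n with 0 => Some l_a0 | 1 => Some l_b0 | 2 => Some l_c0 | 3 => Some l_a1
  | 4 => Some l_b1 | 5 => Some l_c1 | 6 => Some l_p01 | 7 => Some l_p10
  | 8 => Some l_q01 | 9 => Some l_q10 | _ => None end%N.
Lemma lgen2nK : pcancel lgen2n n2lgen. Proof. by move=> u; case: u. Qed.
HB.instance Definition _ := Equality.copy LGen (pcan_type lgen2nK).

(* generators of (W_k, L_l), k l : bool (false = 0, true = 1) *)
Definition gen_ok (k l : bool) (y : Gen) : bool :=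
  match k, l with
  | false, false => (y == g_alpha) || (y == g_beta)
  | false, true  => y == g_gamma
  | true,  false => y == g_tau
  | true,  true  => (y == g_rho) || (y == g_sigma)
  end.

Definition pgen (y : Gen) : int :=
  match y with g_alpha => 0 | g_beta => -2 | g_gamma => -1
  | g_tau => -1 | g_rho => 0 | g_sigma => -2 end.

(* the polygon maps with module input: mu2 u y and mu3 u' u y
   (u the first, u' the second L-input, as in the paper) *)
Definition mu2 (u : LGen) (y : Gen) : option Gen :=
  match u, y with
  | l_a0, g_alpha => Some g_alpha | l_a0, g_beta => Some g_beta
  | l_c0, g_alpha => Some g_beta  | l_a1, g_gamma => Some g_gamma
  | l_q10, g_alpha => Some g_gamma | l_p01, g_gamma => Some g_beta
  | l_a1, g_rho => Some g_rho | l_a1, g_sigma => Some g_sigma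
  | l_c1, g_rho => Some g_sigma | l_a0, g_tau => Some g_tau
  | l_q10, g_tau => Some g_sigma | l_p01, g_rho => Some g_tau
  | _, _ => None end.
Definition mu3 (u' u : LGen) (y : Gen) : option Gen :=
  match u', u, y with
  | l_b0, l_p01, g_gamma => Some g_alpha
  | l_q01, l_q10, g_alpha => Some g_alpha
  | l_c0, l_b0, g_beta => Some g_beta
  | l_p01, l_p10, g_alpha => Some g_alpha
  | l_b1, l_q10, g_tau => Some g_rho
  | l_q10, l_q01, g_sigma => Some g_sigma
  | l_c1, l_b1, g_sigma => Some g_sigma
  | l_p10, l_p01, g_rho => Some g_rho
  | l_p01, l_p10, g_tau => Some g_tau
  | _, _, _ => None end.

(* Tangle diagrams as combinatorial maps.
   Darts: (c,p) = the p-th half-edge at crossing c, p : 'I_4 numbered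
   counterclockwise, p = 0,2 on the understrand and p = 1,3 on the overstrand;
   inr b = the end at the boundary point B_b, with B_0 = 1, B_1 = i,
   B_2 = -1, B_3 = -i. *)
Definition dart (n : nat) := (('I_n * 'I_4) + 'I_4)%type.

Definition q0 : 'I_4 := @Ordinal 4 0 isT.
Definition q1 : 'I_4 := @Ordinal 4 1 isT.
Definition q2 : 'I_4 := @Ordinal 4 2 isT.
Definition q3 : 'I_4 := @Ordinal 4 3 isT.

Record tdiag := TDiag {
  ncr : nat;
  nfree : nat;                        (* crossingless circle components *)
  edge : dart ncr -> dart ncr;        (* the other end of the edge *)
  ori : dart ncr -> bool              (* true: the oriented strand runs
                                         towards the vertex of this dart *)
}.
Arguments edge : clear implicits.
Arguments ori : clear implicits.

Section Diagram.
Variable T : tdiag.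
Local Notation n := (ncr T).
Local Notation D := (dart (ncr T)).

(* rotation around vertices; the outside of the disk is coned to a vertex,
   around which the boundary darts appear in the order 0,3,2,1 *)
Definition rotv (d : D) : D :=
  match d with inl (c, p) => inl (c, p + 1) | inr b => inr (b - 1) end.
Definition graph_rel : rel D :=
  fun d d' => (d' == edge T d) || (d' == rotv d) || (d == rotv d').
Definition facep (d : D) : D := rotv (edge T d).

(* a (planar) 2-tangle diagram: edges form a fixed-point-free involution,
   and Euler's formula V - E + F = 2 #components holds (genus 0) *)
Definition is_tangle_diagram : bool :=
  [forall d, edge T (edge T d) == d] && [forall d, edge T d != d] &&
  (fcard facep predT == n + 1 + 2 * n_comp graph_rel predT)%N.

Definition oriented : bool :=
  [forall d, ori T (edge T d) != ori T d] &&
  [forall c, [forall p, ori T (inl (c, p + 2)) != ori T (inl (c, p))]].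

(* the arcs of T_k: T_0 joins 1,-i and i,-1; T_1 joins 1,i and -1,-i *)
Definition tpart (k : bool) (b : 'I_4) : 'I_4 :=
  if k then (if odd b then b - 1 else b + 1) else 3 - b.

Definition orient_extends (k : bool) : bool :=
  [forall b, ori T (inr (tpart k b)) != ori T (inr b)].

(* sign of a crossing: positive iff the outgoing understrand dart
   follows the outgoing overstrand dart counterclockwise *)
Definition csign (c : 'I_n) : bool :=
  let q := if ori T (inl (c, q1)) then q3 else q1 in
  ~~ ori T (inl (c, q + 1)).
Definition npos : nat := #|[pred c | csign c]|.
Definition nneg : nat := #|[pred c | ~~ csign c]|.

Definition state := {ffun 'I_n -> bool}.
(* 0-resolution: arriving along the overstrand, turn left: joins 1-0, 3-2;
   1-resolution: joins 1-2, 3-0 *)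
Definition smp (r : bool) (p : 'I_4) : 'I_4 :=
  if r then (if odd p then p + 1 else p - 1) else (if odd p then p - 1 else p + 1).
Definition smooth (i : state) (d : D) : D :=
  match d with inl (c, p) => inl (c, smp (i c) p) | inr b => inr b end.
Definition smoothC (k : bool) (i : state) (d : D) : D :=
  match d with inl (c, p) => inl (c, smp (i c) p) | inr b => inr (tpart k b) end.

Definition adjR (i : state) : rel D := fun d d' => (d' == edge T d) || (d' == smooth i d).
Definition adjC (k : bool) (i : state) : rel D :=
  fun d d' => (d' == edge T d) || (d' == smoothC k i d).

Definition onarc (i : state) (d : D) : bool := [exists b, connect (adjR i) d (inr b)].
Definition earr (i : state) (d : D) : bool := connect (adjR i) d (inr q0).
(* l_i : P_i is of type T_1 iff the arc from 1 ends at i *)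
Definition ell (i : state) : bool := connect (adjR i) (inr q0) (inr q1).

(* labellings: the set of darts lying on circles labelled x *)
Definition closed_set (r : rel D) (v : {set D}) : bool :=
  [forall d, [forall d', connect r d d' ==> ((d \in v) == (d' \in v))]].
Definition labK (i : state) (v : {set D}) : bool :=
  closed_set (adjR i) v && [forall d, (d \in v) ==> ~~ onarc i d].
Definition labKh (k : bool) (i : state) (v : {set D}) : bool :=
  closed_set (adjC k i) v && (inr q0 \in v).   (* marked circle labelled x *)

Definition step (i j : state) (c : 'I_n) : bool :=
  (i c == false) && (j == [ffun c' => if c' == c then true else i c']).

Definition dA (c : 'I_n) : D := inl (c, q0).
Definition dB (c : 'I_n) : D := inl (c, q2).

(* coefficient of (w,u) in delta_ji applied to v, from the list of cases *)
Definition kcase (i j : state) (c : 'I_n) (u : LGen) (v w : {set D}) : bool :=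
  let A := dA c in let B := dB c in
  let ci := connect (adjR i) in let cj := connect (adjR j) in
  let aL := if ell i then l_a1 else l_a0 in
  let cL := if ell i then l_c1 else l_c0 in
  if ~~ onarc i A && ~~ onarc i B then
    (if ~~ ci A B then   (* two circles merge: M *)
       (u == aL) && ~~ ((A \in v) && (B \in v)) && ((A \in w) == ((A \in v) || (B \in v)))
     else                (* circle splits: S *)
       (u == aL) && (if A \in v then (A \in w) && (B \in w) else (A \in w) != (B \in w)))
  else if ~~ ci A B then
    (if onarc i A && onarc i B then   (* saddle joining the two arcs *)
       u == (if ell i then l_p01 else l_q10)
     else                              (* circle merges into an arc *)
       let Cd := if onarc i A then B else A in
       let Ad := if onarc i A then A else B in
       if earr i Ad then (u == aL) && (Cd \notin v)
       else ((u == aL) && (Cd \notin v)) || ((u == cL) && (Cd \in v)))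
  else                                 (* a circle splits off an arc *)
    let Cd := if onarc j A then B else A in
    let Ad := if onarc j A then A else B in
    if earr j Ad then (u == aL) && (Cd \in w)
    else ((u == aL) && (Cd \in w)) || ((u == cL) && (Cd \notin w)).

(* u-component of delta_ji: (v,f) |-> coefficient of (w,g) *)
Definition delta (i j : state) (u : LGen) (v : {set D}) (f : {ffun 'I_(nfree T) -> bool})
    (w : {set D}) (g : {ffun 'I_(nfree T) -> bool}) : F :=
  \sum_(c : 'I_n)
    (step i j c && (f == g) && labK i v && labK j w &&
     [forall d, ~~ (connect (adjR i) d (dA c) || connect (adjR i) d (dB c))
                 ==> ((d \in v) == (d \in w))] &&
     kcase i j c u v w)%:R.

Definition BK0 := (state * {set D} * {ffun 'I_(nfree T) -> bool} * Gen)%type.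
Definition validK (k : bool) (x : BK0) : bool :=
  let '(i, v, f, y) := x in labK i v && gen_ok k (ell i) y.
Definition BK (k : bool) := {x : BK0 | validK k x}.

Definition hdeg (i : state) : int := (#|[pred c | i c]|)%:Z - (nneg)%:Z.

Definition bidegK (k : bool) (b : BK k) : int * int :=
  let '(i, v, f, y) := val b in
  let ncirc := (n_comp (adjR i) [pred d | ~~ onarc i d] + nfree T)%N in
  let nx := (n_comp (adjR i) (mem v) + #|[pred t | f t]|)%N in
  ((ncirc)%:Z - 2 * (nx)%:Z + pgen y + (npos)%:Z - (nneg)%:Z + 2 * hdeg i, hdeg i).

(* matrices: M b b' = coefficient of b' in the image of b *)
Definition dK2 (k : bool) (b b' : BK k) : F :=
  let '(i, v, f, y) := val b in let '(j, w, g, z) := val b' in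
  \sum_(u <- lgens) delta i j u v f w g * (mu2 u y == Some z)%:R.
Definition dK3 (k : bool) (b b' : BK k) : F :=
  let '(i, v, f, y) := val b in let '(j', w, g, z) := val b' in
  \sum_(j : state) \sum_(wm : {set D}) \sum_(gm : {ffun 'I_(nfree T) -> bool})
  \sum_(u <- lgens) \sum_(u' <- lgens)
    delta i j u v f wm gm * delta j j' u' wm gm w g * (mu3 u' u y == Some z)%:R.
Definition dK (k : bool) (b b' : BK k) : F := dK2 b b' + dK3 b b'.

Definition BKh0 := (state * {set D} * {ffun 'I_(nfree T) -> bool})%type.
Definition validKh (k : bool) (x : BKh0) : bool :=
  let '(i, v, f) := x in labKh k i v.
Definition BKh (k : bool) := {x : BKh0 | validKh k x}.

Definition gradKh (k : bool) (b : BKh k) : int * int :=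
  let '(i, v, f) := val b in
  let ncirc := (n_comp (adjC k i) predT + nfree T)%N in
  let nx := (n_comp (adjC k i) (mem v) + #|[pred t | f t]|)%N in
  let r := (#|[pred c | i c]|)%:Z in
  ((ncirc)%:Z - 2 * (nx)%:Z + r + (npos)%:Z - 2 * (nneg)%:Z, r - (nneg)%:Z).

Definition khcase (k : bool) (i : state) (c : 'I_n) (v w : {set D}) : bool :=
  let A := dA c in let B := dB c in
  if connect (adjC k i) A B then   (* split *)
    (if A \in v then (A \in w) && (B \in w) else (A \in w) != (B \in w))
  else                             (* merge *)
    ~~ ((A \in v) && (B \in v)) && ((A \in w) == ((A \in v) || (B \in v))).

Definition dKh (k : bool) (b b' : BKh k) : F :=
  let '(i, v, f) := val b in let '(j, w, g) := val b' in
  \sum_(c : 'I_n)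
    (step i j c && (f == g) &&
     [forall d, ~~ (connect (adjC k i) d (dA c) || connect (adjC k i) d (dB c))
                 ==> ((d \in v) == (d \in w))] &&
     khcase k i c v w)%:R.

End Diagram.

Section Homology.
Variables (B : finType) (Dm : B -> B -> F) (gr : B -> int * int).
Definition VB := {ffun B -> F^o}.
Definition dlin : 'End(VB) :=
  linfun (fun f : VB => [ffun c => \sum_b (f b : F) * Dm b c] : VB).
Definition gsub (x : int * int) : {vspace VB} :=
  <<map (fun b => [ffun c => ((c == b)%:R : F)] : VB) [seq b <- enum B | gr b == x]>>%VS.
Definition homdim (x dx : int * int) : nat :=
  let xprev : int * int := (x.1 - dx.1, x.2 - dx.2) in
  (\dim (gsub x :&: lker dlin) - \dim (dlin @: gsub xprev))%N.
End Homology.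

(* Main.v *)
Require Import Defs.
From HB Require Import structures.
From mathcomp Require Import all_boot all_order all_algebra.
From mathcomp Require Import fingroup perm zify.
Import GRing.Theory Num.Theory.
Local Open Scope ring_scope.
Set Implicit Arguments. Unset Strict Implicit. Unset Printing Implicit Defensive.

(** The complex K_{T,k} and the reduced Khovanov complex have the same matrix
    once generators are matched by closing up the arcs: the circle through 1 is
    labelled x, and when T_k closes the two arcs of P_i into two circles, the
    generators alpha, rho (resp. beta, sigma) label the other circle by 1
    (resp. x); gamma and tau occur when both arcs lie on the marked circle.  The
    entries with mu^3 vanish since delta never involves b_i, p_10 or q_01, while
    each nonzero mu^3 has such an input.  Hence everything reduces to Khovanov's
    complex.

    Planarity enters only through a checkerboard colouring chi of the darts,
    alternating along edges and around vertices: by Euler's formula and a rank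
    count over F_2 the constant function 1 is the coboundary of a function on
    faces.  With chi the circles of a resolution are the cycles of a permutation
    and a change of smoothing multiplies it by a transposition, so a saddle
    always merges two circles or splits one.

    For d^2 = 0, a labelling is encoded by a word s of pairwise inequivalent
    darts, one on each circle labelled x.  A merge sends s to s, a split at a
    saddle with ends a, b sends s to (a :: s) + (b :: s), and a word with two
    equivalent letters counts as 0: this is the Khovanov complex as a quotient of
    F_2[X_d]/(X_d^2), with split = multiplication by X_a + X_b. *)

(** * Checkerboard colouring *)

Lemma addFF (x : F) : x + x = 0.
Proof. by rewrite -mulr2n mulrn_pchar // pchar_Fp. Qed.

(** * Functions constant on the classes of an equivalence relation, as row spaces over F_2 *)

Section ConnectMatrix.
Variable D : finType.
Implicit Types e : rel D.

Definition connmx e : 'M[F]_#|D| :=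
  \matrix_(i, j) (connect e (enum_val i) (enum_val j))%:R.

Definition rowfun (f : 'rV[F]_#|D|) (d : D) : F := f 0 (enum_rank d).

Lemma rowfun_inj f g : rowfun f =1 rowfun g -> f = g.
Proof. by move=> fg; apply/rowP=> j; move: (fg (enum_val j)); rewrite /rowfun enum_valK. Qed.

Lemma rowfun_connmx e f d :
  rowfun (f *m connmx e) d = \sum_(x | connect e x d) rowfun f x.
Proof.
rewrite /rowfun mxE (reindex (@enum_rank D)) /=; last first.
  by exists enum_val => x _; rewrite ?enum_valK ?enum_rankK.
rewrite [RHS]big_mkcond; apply: eq_bigr => x _.
by rewrite mxE !enum_rankK; case: connect; rewrite ?mulr1 ?mulr0.
Qed.

Lemma connmx_tr e : connect_sym e -> (connmx e)^T = connmx e.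
Proof. by move=> se; apply/matrixP => i j; rewrite !mxE se. Qed.

Lemma sub_connmxP e f : connect_sym e ->
  reflect (forall x y, connect e x y -> rowfun f x = rowfun f y) (f <= connmx e)%MS.
Proof.
move=> se; apply: (iffP idP) => [/submxP[g ->] x y exy|inv_f].
  by rewrite !rowfun_connmx; apply: eq_bigl => z; rewrite !(se z) (same_connect se exy).
(* One coefficient per class: the value of [f] at the root, and 0 at all other points. *)
apply/submxP; exists (\row_j (if roots e (enum_val j) then f 0 j else 0)).
apply: rowfun_inj => d; rewrite rowfun_connmx (bigD1 (fingraph.root e d)) /=; last first.
  by rewrite se connect_root.
rewrite {2}/rowfun mxE enum_rankK (roots_root se) -/(rowfun f _) big1 ?addr0.
  by apply: inv_f; apply: connect_root.
move=> x /andP[exd xNd]; rewrite /rowfun mxE enum_rankK.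
case: ifP => // /eqP rx; case/negP: xNd; rewrite -rx; apply/eqP.
by apply/eqP; rewrite root_connect.
Qed.

(** The rows at the roots form a basis of the row space: every row equals the row of its root, and
    restricting to the columns at the roots turns these rows into an identity matrix. *)
Lemma rank_connmx e : connect_sym e -> \rank (connmx e) = n_comp e D.
Proof.
move=> se; pose R := [pred x | roots e x && (x \in D)].
have -> : n_comp e D = #|R| by [].
pose B : 'M[F]_(#|R|, #|D|) := \matrix_(a, j) (connect e (enum_val a) (enum_val j))%:R.
have freeB : row_free B.
  apply/row_freeP; exists (\matrix_(j, a) (enum_val j == enum_val a :> D)%:R).
  apply/matrixP=> a b; rewrite !mxE (bigD1 (enum_rank (enum_val b : D))) //= big1.
    rewrite !mxE enum_rankK eqxx mulr1 addr0; congr (_%:R); congr nat_of_bool.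
    have /andP[/eqP ra _] := enum_valP a; have /andP[/eqP rb _] := enum_valP b.
    by rewrite -(root_connect se) ra rb (inj_eq enum_val_inj).
  move=> j jb; rewrite !mxE; case: eqP => [jE|]; rewrite ?mulr0 //.
  by case/eqP: jb; rewrite -jE enum_valK.
rewrite -(eqP freeB); apply/eqP; rewrite eqn_leq; apply/andP; split; apply: mxrankS.
  apply/row_subP => i; set r := fingraph.root e (enum_val i).
  have Rr : r \in R by rewrite inE /= (roots_root se) inE.
  have -> : row i (connmx e) = row (enum_rank_in Rr r) B.
    apply/rowP => j; rewrite !mxE enum_rankK_in // /r.
    by rewrite (same_connect se (connect_root e _)).
  exact: row_sub.
apply/row_subP => a.
have -> : row a B = row (enum_rank (enum_val a : D)) (connmx e).
  by apply/rowP => j; rewrite !mxE enum_rankK.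
exact: row_sub.
Qed.

End ConnectMatrix.

(** In the application [f], [r], [e], [c] count faces, vertices, edges and components; [a] is the
    rank of the boundary from edges to vertices and [k] the dimension of its kernel; [m] is the rank
    of the boundary from faces to edges; [b] is the dimension of the vertex functions that agree at
    both ends of every edge. *)
Fact euler_arith (f r e c a b k m : nat) :
  (f + r = e + 2 * c -> f <= c + m -> b <= c -> a + b = r -> a + k = e -> k <= m)%N.
Proof. by lia. Qed.

(** * The mod 2 chain complex of a planar four-valent map *)

Section Checkerboard.
Variables (D : finType) (e r : D -> D) (g : rel D).
Hypothesis eK : involutive e.
Hypothesis eN : forall d, e d != d.
Hypothesis injr : injective r.
Hypothesis ord_r : forall d, fingraph.order r d = 4%N.
Hypothesis sg : symmetric g.
Hypothesis gP : forall f : D -> F,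
  (forall x, f (e x) = f x) -> (forall x, f (r x) = f x) -> forall x y, g x y -> f x = f y.
Hypothesis euler : (fcard (r \o e) D + fcard r D = fcard e D + 2 * n_comp g D)%N.

Let inje : injective e := inv_inj eK.
Let sce : connect_sym (frel e). Proof. exact: fconnect_sym. Qed.
Let scr : connect_sym (frel r). Proof. exact: fconnect_sym. Qed.
Let scf : connect_sym (frel (r \o e)).
Proof. by apply: fconnect_sym; apply: inj_comp. Qed.
Let scg : connect_sym g. Proof. exact: sym_connect_sym. Qed.
Let Qe := connmx (frel e).
Let Qr := connmx (frel r).
Let Qf := connmx (frel (r \o e)).
Let Qg := connmx g.

Lemma fconnect_inv (h : D -> F) (s : D -> D) :
  (forall x, h (s x) = h x) -> forall x y, fconnect s x y -> h x = h y.
Proof.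
move=> hs x y /iter_findex <-; elim: (findex _ _ _) => //= k IH.
by rewrite hs.
Qed.

Let invQe f : reflect (forall x, rowfun f (e x) = rowfun f x) (f <= Qe)%MS.
Proof.
apply: (iffP (sub_connmxP f sce)) => h; last exact: fconnect_inv.
by move=> x; symmetry; apply: h; apply: fconnect1.
Qed.

Let invQr f : reflect (forall x, rowfun f (r x) = rowfun f x) (f <= Qr)%MS.
Proof.
apply: (iffP (sub_connmxP f scr)) => h; last exact: fconnect_inv.
by move=> x; symmetry; apply: h; apply: fconnect1.
Qed.

Let invQf f : reflect (forall x, rowfun f (r (e x)) = rowfun f x) (f <= Qf)%MS.
Proof.
apply: (iffP (sub_connmxP f scf)) => h; last exact: fconnect_inv.
by move=> x; symmetry; apply: h; apply: (fconnect1 (r \o e)).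
Qed.

Let invQg f : (forall x, rowfun f (e x) = rowfun f x) ->
  (forall x, rowfun f (r x) = rowfun f x) -> (f <= Qg)%MS.
Proof.
move=> fe fr; apply/(sub_connmxP f scg) => x y /connectP[p].
elim: p x => [x _ -> //|z p IH x /= /andP[gxz gp] Hy].
by rewrite (gP fe fr gxz); apply: IH.
Qed.

Let fconne x d : fconnect e x d = (x == d) || (x == e d).
Proof.
apply/idP/idP => [/iter_findex <-|/orP[]/eqP->]; last 2 first.
- exact: connect0.
- by rewrite sce fconnect1.
elim: (findex _ _ _) => [|k] /=; first by rewrite eqxx.
by case/orP => [/eqP <-|/eqP{1}->]; rewrite ?eK ?eqxx ?orbT.
Qed.

Let mulQe f d : rowfun (f *m Qe) d = rowfun f d + rowfun f (e d).
Proof.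
rewrite rowfun_connmx (bigD1 d) ?connect0 //=; congr (_ + _).
rewrite (big_pred1 (e d)) // => x /=; rewrite fconne.
by case: (x =P d) => [->|] /=; rewrite ?andbT // eq_sym (negPf (eN d)).
Qed.

(** In characteristic 2 a function killed by [Qe] takes equal values at both ends of an edge. With
    face functions for [A] this bounds H_2, with vertex functions it bounds H^0. *)
Let rank_capQe (A : 'M[F]_#|D|) :
  (forall f : 'rV_#|D|, (f <= A)%MS -> (f <= Qe)%MS -> (f <= Qg)%MS) ->
  (\rank (A :&: kermx Qe) <= n_comp g D)%N.
Proof.
move=> AQ; rewrite -(rank_connmx scg); apply: mxrankS.
apply/row_subP => i; set f := row i _.
have: (f <= A :&: kermx Qe)%MS by apply: row_sub.
rewrite sub_capmx => /andP[fA /sub_kermxP fQ]; apply: AQ => //.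
apply/invQe => x; have := mulQe f x; rewrite fQ {1}/rowfun mxE => /esym/eqP.
by rewrite addr_eq0 => /eqP ->; apply/eqP; rewrite -subr_eq0 opprK addFF.
Qed.

(** Multiplication by [Qe] and then by [Qr] is the complex of faces, edges and vertices. Euler's
    formula leaves no room for homology at the edges, so every cycle is a boundary. The sum of all
    edges is a cycle because vertices have even degree, and a face function bounding it takes
    different values on the two sides of each edge. *)
Lemma checkerboard : exists chi : D -> bool,
  (forall d, chi (e d) = ~~ chi d) /\ (forall d, chi (r d) = ~~ chi d).
Proof.
have sub_ker (A : 'M[F]_#|D|) : (forall f : 'rV_#|D|, (f <= A)%MS -> f *m Qr = 0) -> A *m Qr = 0.
  by move=> h; apply/row_matrixP => i; rewrite row_mul row0 h // row_sub.
(* The boundary squares to zero: for a face function, [f (e x)] is [f (r x)], so the sum around a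
   vertex contains every value twice. *)
have subK : (Qf *m Qe <= Qe :&: kermx Qr)%MS.
  rewrite sub_capmx submxMl /=; apply/sub_kermxP; apply: sub_ker => f0 /submxP[f1 ->].
  rewrite mulmxA; set f := f1 *m Qf; have /invQf ff : (f <= Qf)%MS by apply: submxMl.
  apply: rowfun_inj => d; rewrite rowfun_connmx {2}/rowfun mxE.
  under eq_bigr => x _ do rewrite mulQe -(ff (e x)) eK.
  rewrite big_split /= [X in _ + X](_ : _ = \sum_(x | fconnect r x d) rowfun f x) ?addFF //.
  rewrite [RHS](reindex_inj injr) /=; apply: eq_bigl => x.
  by rewrite (same_fconnect1 injr).
have rankQf : (n_comp g D + \rank (Qf *m Qe) >= fcard (r \o e) D)%N.
  rewrite -(rank_connmx scf) -/Qf -(mxrank_mul_ker Qf Qe) addnC leq_add2r.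
  apply: rank_capQe => f /invQf ff /invQe fe; apply: invQg => // x.
  by rewrite -{1}(eK x) ff fe.
have rankK : (\rank (Qe :&: kermx Qr) <= \rank (Qf *m Qe))%N.
  (* The matrices are symmetric, so the boundary from edges to vertices has the same rank as the
     coboundary from vertices to edges, whose kernel is bounded by the number of components. *)
  have trQ : \rank (Qe *m Qr) = \rank (Qr *m Qe).
    by rewrite -mxrank_tr trmx_mul !connmx_tr.
  have := mxrank_mul_ker Qe Qr; rewrite trQ.
  have := mxrank_mul_ker Qr Qe.
  have : (\rank (Qr :&: kermx Qe) <= n_comp g D)%N.
    by apply: rank_capQe => f /invQr fr /invQe fe; apply: invQg.
  rewrite (rank_connmx sce) (rank_connmx scr); move: euler rankQf.
  exact: euler_arith.
have : ((const_mx 1 : 'rV[F]_#|D|) <= Qf *m Qe)%MS.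
  have /leqifP := mxrank_leqif_sup subK.
  case: ifP => [sub _|_]; last by rewrite ltnNge rankK.
  apply: submx_trans sub; rewrite sub_capmx; apply/andP; split.
    by apply/invQe => x; rewrite /rowfun !mxE.
  apply/sub_kermxP; apply: rowfun_inj => d; rewrite rowfun_connmx.
  under eq_bigr => x _ do rewrite /rowfun mxE.
  rewrite sumr_const /rowfun mxE (eq_card (B := fconnect r d)) => [|x]; last first.
    by rewrite !inE fconnect_sym.
  by rewrite -[#|_|]/(fingraph.order r d) ord_r; apply/eqP.
case/submxP => h; rewrite mulmxA; set f := h *m Qf => hE.
have /invQf ff : (f <= Qf)%MS by apply: submxMl.
have fe d : rowfun f (e d) = rowfun f d + 1.
  have := mulQe f d; rewrite -hE {1}/rowfun mxE => ->.
  by rewrite addrA addFF add0r.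
have F2 (x : F) : (x + 1 == 1) = ~~ (x == 1) by case: x => [[|[|]]].
exists (fun d => rowfun f d == 1); split=> d; first by rewrite fe F2.
(* Since [f] is constant along [r \o e], its value at [r d] is its value at [e d]. *)
by rewrite -{1}(eK d) ff fe F2.
Qed.
End Checkerboard.

(** * Change of smoothing *)

Definition adj (D : eqType) (e s : D -> D) : rel D :=
  fun d d' => (d' == e d) || (d' == s d).

Lemma connect_ind (T : finType) (r : rel T) (Q : T -> Prop) :
  (forall x y, r x y -> Q x -> Q y) -> forall x y, connect r x y -> Q x -> Q y.
Proof.
move=> stepQ x y /connectP[p]; elim: p x => [|z p IH] x /=; first by move=> _ ->.
by case/andP => rxz pth yE Qx; apply: IH pth yE _; apply: stepQ rxz Qx.
Qed.

(* the equivalence relation generated by [E] and the pair [(a, b)] *)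
Definition addE (T : Type) (E : rel T) (a b : T) : rel T :=
  fun x y => E x y || (E x a || E x b) && (E y a || E y b).

Section AddE.
Variables (T : finType) (E : rel T) (a b : T).
Hypotheses (Er : reflexive E) (Es : symmetric E) (Et : transitive E).

Lemma addE_trans : transitive (addE E a b).
Proof.
have H x y : E x y -> (E x a || E x b) = (E y a || E y b).
  move=> xy; have yx : E y x by rewrite Es.
  by apply/orP/orP; (case=> ?; [left|right]); apply: Et; eauto.
move=> y x z; rewrite /addE => /orP[xy|/andP[tx ty]] /orP[yz|/andP[ty' tz]].
- by rewrite (Et xy yz).
- by rewrite (H _ _ xy) ty' tz orbT.
- by rewrite -(H _ _ yz) tx ty orbT.
- by rewrite tx tz orbT.
Qed.

Lemma addE_sym : symmetric (addE E a b).
Proof. by move=> x y; rewrite /addE Es andbC. Qed.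

Lemma addE_refl : reflexive (addE E a b).
Proof. by move=> x; rewrite /addE Er. Qed.

Lemma addE_id : E a b -> addE E a b =2 E.
Proof.
move=> ab x y; rewrite /addE; case: (boolP (E x y)) => //=.
apply: contraNF => /andP[xa ya].
have Ha z : E z a || E z b -> E z a.
  by case/orP => // zb; apply: Et zb _; rewrite Es.
by apply: Et (Ha _ xa) _; rewrite Es Ha.
Qed.
End AddE.

(** The target is an equivalence relation, so only the generating steps of [r'] have to be
    tested. *)
Lemma addE_connect_sub (T : finType) (r r' : rel T) (a b : T) :
  connect_sym r -> connect_sym r' ->
  (forall x y, r' x y -> addE (connect r) a b x y) ->
  subrel (addE (connect r') a b) (addE (connect r) a b).
Proof.
move=> sr sr' sub.
have tr := addE_trans (a := a) (b := b) sr (@connect_trans _ r).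
have sub' x y : connect r' x y -> addE (connect r) a b x y.
  move=> /(connect_ind (Q := addE (connect r) a b x)); apply; last exact/addE_refl/connect0.
  by move=> z z' /sub zz' xz; apply: tr xz zz'.
have ta : addE (connect r) a b b a by rewrite /addE !connect0 !orbT.
have tot z : connect r' z a || connect r' z b -> addE (connect r) a b z a.
  by case/orP => /sub' // zb; apply: tr zb ta.
move=> x y /orP[/sub' //|/andP[/tot xa /tot ya]].
by apply: tr xa _; rewrite addE_sym.
Qed.

Section Adj.
Variables (D : finType) (e s : D -> D).
Hypotheses (eK : involutive e) (sK : involutive s).

Lemma adj_sym : symmetric (adj e s).
Proof. by move=> x y; rewrite /adj -(inv_eq eK) -(inv_eq sK) !(eq_sym x). Qed.

Lemma adj_csym : connect_sym (adj e s).
Proof. exact: sym_connect_sym adj_sym. Qed.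

Lemma connect_adj_e x : connect (adj e s) x (e x).
Proof. by apply: connect1; rewrite /adj eqxx. Qed.

Lemma connect_adj_s x : connect (adj e s) x (s x).
Proof. by apply: connect1; rewrite /adj eqxx orbT. Qed.

Variable chi : D -> bool.
Hypotheses (chi_e : forall d, chi (e d) = ~~ chi d)
           (chi_s : forall d, chi (s d) = ~~ chi d).

(** Walking along a circle two steps at a time stays within one colour. The points coloured true are
    permuted this way, one cycle for each circle; the other points are fixed so as to obtain a
    permutation of the whole type. *)
Definition turn_fun d := if chi d then e (s d) else d.

Lemma turn_inj : injective turn_fun.
Proof.
have chi_t x : chi (turn_fun x) = chi x.
  by rewrite /turn_fun; case: ifP; rewrite ?chi_e ?chi_s ?negbK.
move=> x y xy; have := congr1 chi xy; rewrite !chi_t => cxy.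
move: xy; rewrite /turn_fun cxy; case: ifP => // _ /(can_inj eK) /(can_inj sK) //.
Qed.

Definition turn := perm turn_inj.

Lemma porbit_turn x y : chi x -> chi y ->
  (y \in porbit turn x) = connect (adj e s) x y.
Proof.
move=> cx cy; apply/idP/idP => [/porbitP[i ->]|].
  elim: i => [|i IH]; first by rewrite expg0 perm1.
  rewrite expgSr permM; apply: connect_trans IH _.
  rewrite permE /turn_fun; case: ifP => // _.
  exact: connect_trans (connect_adj_s _) (connect_adj_e _).
have turnO z : (turn z \in porbit turn x) = (z \in porbit turn x).
  by rewrite -!eq_porbit_mem (porbit_perm turn 1).
(* the orbit of [x], completed by the [e]-images of its points, is closed under [e] and [s] *)
pose inO z := (if chi z then z else e z) \in porbit turn x.
have stepO z z' : adj e s z z' -> inO z -> inO z'.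
  case/orP => /eqP ->; rewrite /inO ?chi_e ?chi_s; case: ifP => cz /= zO.
  - by rewrite eK.
  - by [].
  - by rewrite -turnO permE /turn_fun cz in zO.
  - by rewrite -turnO permE /turn_fun chi_s cz sK.
move=> /(connect_ind stepO); rewrite /inO cx cy; apply; exact: porbit_id.
Qed.
End Adj.

(** * Effect of a single saddle on connectivity *)

Section Resmoothing.
Variables (D : finType) (e s s' : D -> D) (chi : D -> bool) (p0 p1 p2 p3 : D).
Hypotheses (eK : involutive e) (sK : involutive s) (sK' : involutive s').
Hypotheses (chi_e : forall d, chi (e d) = ~~ chi d)
           (chi_s : forall d, chi (s d) = ~~ chi d)
           (chi_s' : forall d, chi (s' d) = ~~ chi d).
Hypotheses (s0 : s p0 = p1) (s2 : s p2 = p3) (s'0 : s' p0 = p3) (s'2 : s' p2 = p1).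
Hypothesis s's : forall d, d \notin [:: p0; p1; p2; p3] -> s' d = s d.
Hypotheses (p02 : p0 != p2) (chi02 : chi p0 = chi p2).

(** The permutations of the two smoothings differ by the transposition of [p0] and [p2]. Such a
    product gains a cycle if the two points share one and loses a cycle otherwise; comparing the
    count in both directions leaves exactly one smoothing that connects them. *)
Lemma resmooth_xor : connect (adj e s') p0 p2 = ~~ connect (adj e s) p0 p2.
Proof.
(* The colour is normalised so that [p0] and [p2] are among the points moved by the turning
   permutations. *)
pose chi0 d := chi d == chi p0.
have chi0N f : (forall d, chi (f d) = ~~ chi d) -> forall d, chi0 (f d) = ~~ chi0 d.
  by move=> chi_f d; rewrite /chi0 chi_f; case: (chi d); case: (chi p0).
have cp0 : chi0 p0 by apply/eqP.
have cp2 : chi0 p2 by apply/eqP.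
pose t := turn eK sK (chi0N _ chi_e) (chi0N _ chi_s).
pose t' := turn eK sK' (chi0N _ chi_e) (chi0N _ chi_s').
have tE : t' = (tperm p0 p2 * t)%g.
  apply/permP => d; rewrite permM [LHS]permE [RHS]permE /turn_fun.
  case: (tpermP p0 p2 d) => [->|->|/eqP d0 /eqP d2].
  - by rewrite cp0 cp2 s'0 s2.
  - by rewrite cp0 cp2 s'2 s0.
  case: ifP => // cd; rewrite s's // !inE (negPf d0) (negPf d2) /=.
  apply/negP => /orP[]/eqP dE; move: cd; rewrite dE.
    by rewrite -s0 (chi0N _ chi_s) cp0.
  by rewrite -s2 (chi0N _ chi_s) cp2.
have tE' : t = (tperm p0 p2 * t')%g by rewrite tE mulgA tperm2 mul1g.
have := porbits_mul_tperm t p0 p2; have := porbits_mul_tperm t' p0 p2.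
rewrite /= -tE -tE' p02 !porbit_turn //.
rewrite (adj_csym eK sK p2) (adj_csym eK sK' p2).
by case: connect; case: connect => //=; lia.
Qed.

(** The smoothings differ only at [p0], ..., [p3], and in either of them each of these four points
    is connected to [p0] or to [p2]. *)
Lemma addE_resmooth : addE (connect (adj e s)) p0 p2 =2 addE (connect (adj e s')) p0 p2.
Proof.
pose P := [:: p0; p1; p2; p3].
have cs := adj_csym eK sK; have cs' := adj_csym eK sK'.
have tP x : x \in P -> connect (adj e s) x p0 || connect (adj e s) x p2.
  rewrite !inE => /or4P[]/eqP->; rewrite ?connect0 ?orbT //.
    by rewrite -s0 cs connect_adj_s.
  by rewrite -s2 orbC cs connect_adj_s.
have tP' x : x \in P -> connect (adj e s') x p0 || connect (adj e s') x p2.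
  rewrite !inE => /or4P[]/eqP->; rewrite ?connect0 ?orbT //.
    by rewrite -s'2 orbC cs' connect_adj_s.
  by rewrite -s'0 cs' connect_adj_s.
have sP x : x \in P -> (s x \in P) && (s' x \in P).
  have s1 : s p1 = p0 by rewrite -s0 sK.
  have s3 : s p3 = p2 by rewrite -s2 sK.
  have s'1 : s' p1 = p2 by rewrite -s'2 sK'.
  have s'3 : s' p3 = p0 by rewrite -s'0 sK'.
  by rewrite !inE => /or4P[]/eqP->; rewrite ?s0 ?s1 ?s2 ?s3 ?s'0 ?s'1 ?s'2 ?s'3 !eqxx ?orbT.
move=> x y; apply/idP/idP; apply: addE_connect_sub => // {x y} x y /orP[]/eqP->.
- by rewrite /addE connect_adj_e.
- have [xP|/s's <-] := boolP (x \in P); last by rewrite /addE connect_adj_s.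
  by have /andP[sxP _] := sP _ xP; rewrite /addE !tP' // orbT.
- by rewrite /addE connect_adj_e.
- have [xP|/s's ->] := boolP (x \in P); last by rewrite /addE connect_adj_s.
  by have /andP[_ sxP] := sP _ xP; rewrite /addE !tP // orbT.
Qed.
End Resmoothing.

(** * The Khovanov maps on words *)

Section Words.
Variable T : finType.
Implicit Types (E : rel T) (s : seq T) (v w : {set T}).

Definition equivr E := [/\ reflexive E, symmetric E & transitive E].

Lemma equivr_connect (e : rel T) : connect_sym e -> equivr (connect e).
Proof. by move=> se; split; [exact: connect0 | exact: se | exact: connect_trans]. Qed.

Definition saturated E v := [forall d, [forall d', E d d' ==> ((d \in v) == (d' \in v))]].

Lemma saturatedP E v :
  reflect (forall x y, E x y -> (x \in v) = (y \in v)) (saturated E v).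
Proof.
apply: (iffP forallP) => [h x y xy|h x].
  by have /forallP/(_ y)/implyP/(_ xy)/eqP := h x.
by apply/forallP => y; apply/implyP => /h ->.
Qed.

Definition cl E s : {set T} := [set d | has (E d) s].
Definition okw E s := pairwise (fun x y => ~~ E x y) s.

Lemma in_cl_cons E a s d : (d \in cl E (a :: s)) = E d a || (d \in cl E s).
Proof. by rewrite !inE. Qed.

Lemma okw_cons E a s : okw E (a :: s) = (a \notin cl E s) && okw E s.
Proof. by rewrite /okw /= inE; congr (_ && _); elim: s => //= x s ->; rewrite negb_or. Qed.

Lemma cl_sim E s x y : equivr E -> E x y -> (x \in cl E s) = (y \in cl E s).
Proof.
case=> _ Es Et xy; rewrite !inE; apply: eq_has => z.
by apply/idP/idP; apply: Et => //; rewrite Es.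
Qed.

Lemma saturated_cl E s : equivr E -> saturated E (cl E s).
Proof. by move=> eqE; apply/saturatedP => x y xy; apply: cl_sim. Qed.

(** Representatives are chosen greedily from an enumeration of [v]: a point becomes a letter unless
    its class is already covered. *)
Lemma saturated_word E v : equivr E -> saturated E v -> exists2 s, okw E s & cl E s = v.
Proof.
move=> eqE /saturatedP sat; have [Er Es Et] := eqE.
have [s oks clE] : exists2 s, okw E s & cl E s = cl E (enum v).
  elim: (enum v) => [|x l [s oks clE]]; first by exists [::].
  have [xs|xs] := boolP (x \in cl E s).
    exists s => //; apply/setP => d; rewrite in_cl_cons clE.
    by case: (boolP (E d x)) => // dx; rewrite -clE (cl_sim _ eqE dx) xs.
  exists (x :: s); first by rewrite okw_cons xs.
  by apply/setP => d; rewrite !in_cl_cons clE.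
exists s => //; rewrite clE; apply/setP => d; rewrite inE.
apply/hasP/idP => [[x]|dv]; first by rewrite mem_enum => xv /sat ->.
by exists d; rewrite ?mem_enum.
Qed.

Lemma n_comp_cl (e : rel T) s : connect_sym e -> okw (connect e) s ->
  n_comp e (cl (connect e) s) = size s.
Proof.
move=> se oks; rewrite -(size_map (fingraph.root e)).
have /card_uniqP <- : uniq [seq fingraph.root e x | x <- s].
  rewrite uniq_pairwise pairwise_map; congr is_true: oks.
  by apply: eq_pairwise => x y /=; rewrite (root_connect se).
apply: eq_card => x; rewrite !inE.
apply/andP/mapP => [[/eqP rx /hasP[y ys xy]]|[y ys ->]].
  by exists y => //; rewrite -rx; apply/eqP; rewrite root_connect.
split; first exact: roots_root.
by apply/hasP; exists y => //; rewrite se connect_root.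
Qed.

Lemma cl_addE E E' a b s : E' =2 addE E a b -> symmetric E -> forall d, (d \in cl E' s) =
  (d \in cl E s) || (E d a || E d b) && ((a \in cl E s) || (b \in cl E s)).
Proof.
move=> EE Es d; elim: s => [|x s IH]; first by rewrite !inE andbF.
rewrite !in_cl_cons IH EE /addE (Es a x) (Es b x).
by case: (E d a); case: (E d b); case: (E x a); case: (E x b); case: (E d x);
  case: (d \in _); case: (a \in _); case: (b \in _).
Qed.

Lemma okw_addE E E' a b s : equivr E -> E' =2 addE E a b -> ~~ E a b ->
  okw E' s = okw E s && ~~ ((a \in cl E s) && (b \in cl E s)).
Proof.
move=> eqE EE nab; have [Er Es Et] := eqE; elim: s => [|x s IH]; first by rewrite !inE.
rewrite !okw_cons IH !in_cl_cons (cl_addE _ EE Es) (Es a x) (Es b x).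
have ha : E x a -> (x \in cl E s) = (a \in cl E s) by exact: cl_sim.
have hb : E x b -> (x \in cl E s) = (b \in cl E s) by exact: cl_sim.
have hab : ~~ (E x a && E x b).
  by apply: contra nab => /andP[xa xb]; apply: Et xb; rewrite Es.
move: ha hb hab; case: (E x a); case: (E x b) => //= ha hb _.
- by rewrite ha //; case: (a \in _); case: (b \in _); rewrite ?andbF.
- by rewrite hb //; case: (a \in _); case: (b \in _); rewrite ?andbF.
- by rewrite orbF andbA.
Qed.

(* the coefficient of [w] in the Khovanov map applied to [v], for a saddle at
   the points [a], [b] that turns the circles of [E] into those of [E'] *)
Definition kh E E' a b v w :=
  [&& saturated E' w,
      [forall d, ~~ (E d a || E d b) ==> ((d \in v) == (d \in w))] &
      if E a b then
        if a \in v then (a \in w) && (b \in w) else (a \in w) != (b \in w)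
      else ~~ ((a \in v) && (b \in v)) && ((a \in w) == ((a \in v) || (b \in v)))].

(** A saddle in a form symmetric in its two ends; [cobP] reads it as a merge or as a split. *)
Definition cob E E' a b := addE E a b =2 addE E' a b /\ E' a b = ~~ E a b.

(** The coefficient of the labelling [w] in the monomial of the word [s]; a word with two equivalent
    letters is zero. *)
Definition ind E s w := okw E s && (w == cl E s).

Lemma eq_clP E s a w : equivr E ->
  (w == cl E s) = [&& saturated E w, [forall d, ~~ E d a ==> ((d \in cl E s) == (d \in w))]
                      & (a \in w) == (a \in cl E s)].
Proof.
move=> eqE; apply/eqP/and3P => [->|[/saturatedP sat /forallP off /eqP aw]].
  by split; rewrite ?saturated_cl //; apply/forallP => d; rewrite eqxx implybT.
apply/setP => d; have [da|nda] := boolP (E d a).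
  by rewrite (sat _ _ da) aw -(cl_sim s eqE da).
by rewrite (eqP (implyP (off d) nda)).
Qed.

(** A word with a letter on each merging circle acquires two equivalent letters, which matches the
    rule that x times x is 0. *)
Lemma kh_merge E E' a b s w : equivr E -> equivr E' -> E' =2 addE E a b -> ~~ E a b ->
  okw E s && kh E E' a b (cl E s) w = ind E' s w.
Proof.
move=> eqE eqE' EE nab; have [Er Es Et] := eqE.
have E'a d : E' d a = E d a || E d b.
  by rewrite EE /addE Er /=; case: (E d a) => //=; case: (E d b); rewrite ?andbF.
rewrite /ind (okw_addE _ eqE EE nab) (eq_clP _ a _ eqE') /kh (negPf nab).
rewrite (eq_forallb (P2 := fun d => ~~ E' d a ==> ((d \in cl E' s) == (d \in w)))); last first.
  move=> d; rewrite -E'a (cl_addE _ EE Es) -E'a.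
  by case: (E' d a) => //=; rewrite orbF.
rewrite (cl_addE _ EE Es) Er /=.
by case: (a \in cl _ _); case: (b \in cl _ _); case: (a \in w); case: (okw _ _);
  rewrite /= ?andbF ?andbT.
Qed.

(** If the splitting circle is labelled x, the word has one letter on one of the two new circles:
    adding a letter there gives zero, and adding one on the other circle labels both by x. If it is
    labelled 1, the two words are the two terms of S(1). *)
Lemma kh_split E E' a b s w : equivr E -> equivr E' -> E =2 addE E' a b -> ~~ E' a b ->
  okw E s && kh E E' a b (cl E s) w = ind E' (a :: s) w (+) ind E' (b :: s) w.
Proof.
move=> eqE eqE' EE nab; have [Er Es Et] := eqE'.
have Ea d : E d a = E' d a || E' d b.
  by rewrite EE /addE Er /=; case: (E' d a) => //=; case: (E' d b); rewrite ?andbF.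
have Eb d : E d b = E' d a || E' d b.
  by rewrite EE /addE Er /= orbT; case: (E' d a) => //=; case: (E' d b); rewrite ?andbF ?andbT.
pose S0 := saturated E' w && [forall d, ~~ (E d a || E d b) ==> ((d \in cl E s) == (d \in w))].
have ind_cons x y : (x = a /\ y = b \/ x = b /\ y = a) ->
    (w == cl E' (x :: s)) = [&& S0, x \in w & (y \in w) == (y \in cl E' s)].
  move=> xy.
  have nyx : E' y x = false by case: xy => [][-> ->]; apply/negbTE; rewrite // Es.
  have off d : E d a || E d b = E' d x || E' d y.
    by rewrite Ea Eb orbb; case: xy => [][-> ->] //; rewrite orbC.
  apply/eqP/idP => [wE|/and3P[/andP[/saturatedP sat /forallP offP] xw /eqP yw]].
    rewrite /S0 wE saturated_cl //= !in_cl_cons Er nyx /= eqxx andbT.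
    apply/forallP => d; apply/implyP; rewrite off negb_or => /andP[dx dy].
    rewrite (cl_addE _ EE Es) in_cl_cons (negPf dx).
    have := off d; rewrite Ea Eb orbb (negPf dx) (negPf dy) => -> /=.
    by rewrite orbF.
  apply/setP => d; rewrite in_cl_cons.
  have [dx|ndx] := boolP (E' d x); first by rewrite (sat _ _ dx) xw.
  have [dy|ndy] := boolP (E' d y); first by rewrite (sat _ _ dy) yw -(cl_sim s eqE' dy).
  have td : ~~ (E d a || E d b) by rewrite off negb_or ndx.
  rewrite -(eqP (implyP (offP d) td)) (cl_addE _ EE Es) /=.
  by move: td; rewrite Ea Eb orbb => /negPf -> /=; rewrite orbF.
have -> : okw E s && kh E E' a b (cl E s) w = okw E s && S0 &&
    (if a \in cl E s then (a \in w) && (b \in w) else (a \in w) != (b \in w)).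
  by rewrite /kh EE /addE Er Er /= orbT orbT !andbA.
rewrite /ind !okw_cons (ind_cons a b) ?(ind_cons b a); [|by right|by left].
rewrite (okw_addE _ eqE' EE nab) (cl_addE _ EE Es) Er /=.
by case: (a \in cl _ _); case: (b \in cl _ _); case: (a \in w); case: (b \in w);
  rewrite /= ?andbF ?andbT //; case: (okw _ _); case: (S0).
Qed.

Definition words E a b s := if E a b then [:: a :: s; b :: s] else [:: s].

Lemma natr_addb (x y : bool) : (x (+) y)%:R = x%:R + y%:R :> F.
Proof. by case: x; case: y; rewrite /= ?addFF ?addr0 ?add0r. Qed.

Lemma cobP E E' a b : equivr E -> equivr E' -> cob E E' a b ->
  if E a b then E =2 addE E' a b /\ ~~ E' a b else E' =2 addE E a b.
Proof.
move=> [Er Es Et] [E'r E's E't] [EE E'ab].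
case: ifP => ab; rewrite ab in E'ab.
  by rewrite E'ab; split=> // x y; rewrite -EE addE_id.
by move=> x y; rewrite EE addE_id // E'ab.
Qed.

Lemma kh_words E E' a b s w : equivr E -> equivr E' -> cob E E' a b ->
  (okw E s && kh E E' a b (cl E s) w)%:R = \sum_(t <- words E a b s) (ind E' t w)%:R :> F.
Proof.
move=> eqE eqE' /(cobP eqE eqE'); rewrite /words; case: ifP => ab.
  by case=> EE nab; rewrite kh_split // natr_addb big_cons big_seq1.
by move=> EE; rewrite kh_merge ?ab // big_seq1.
Qed.

Lemma sum_ind_kh E' E'' a b s w : equivr E' -> equivr E'' -> cob E' E'' a b ->
  \sum_w' (ind E' s w' && kh E' E'' a b w' w)%:R =
  \sum_(t <- words E' a b s) (ind E'' t w)%:R :> F.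
Proof.
move=> eqE' eqE'' cE; rewrite -kh_words // (bigD1 (cl E' s)) //= big1 ?addr0.
  by rewrite /ind eqxx andbT.
by move=> w' /negPf w's; rewrite /ind w's andbF.
Qed.

Lemma kh_comp E E' E'' a b a' b' v w : equivr E -> equivr E' -> equivr E'' ->
  cob E E' a b -> cob E' E'' a' b' -> forall s, okw E s -> cl E s = v ->
  \sum_w' (kh E E' a b v w' && kh E' E'' a' b' w' w)%:R =
  \sum_(t <- words E a b s) \sum_(t' <- words E' a' b' t) (ind E'' t' w)%:R :> F.
Proof.
move=> eqE eqE' eqE'' cE cE' s oks <-.
under [RHS]eq_bigr => t _ do rewrite -(sum_ind_kh _ _ eqE' eqE'' cE').
rewrite exchange_big /=; apply: eq_bigr => w' _.
have -> : kh E E' a b (cl E s) w' = okw E s && kh E E' a b (cl E s) w' by rewrite oks.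
case: (kh E' _ _ _ _ _); last by rewrite andbF big1 // => t _; rewrite andbF.
by rewrite andbT kh_words //; apply: eq_bigr => t _; rewrite andbT.
Qed.

(** Together with [ind_swap], these are the relations of the commutative ring in which equivalent
    points give the same variable. *)
Lemma ind_sim E s a b w : equivr E -> E a b -> ind E (a :: s) w = ind E (b :: s) w.
Proof.
move=> eqE ab; have [Er Es Et] := eqE; rewrite /ind !okw_cons (cl_sim s eqE ab).
congr (_ && (_ == _)); apply/setP => d; rewrite !in_cl_cons; congr (_ || _).
by apply/idP/idP => H; apply: Et H _; rewrite // Es.
Qed.

Lemma ind_swap E s a b w : equivr E -> ind E [:: a, b & s] w = ind E [:: b, a & s] w.
Proof.
move=> [Er Es Et]; rewrite /ind !okw_cons !in_cl_cons !negb_or Es.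
have -> : cl E [:: a, b & s] = cl E [:: b, a & s].
  by apply/setP => d; rewrite !in_cl_cons orbCA.
by congr (_ && _); rewrite !andbA; congr (_ && _); rewrite -!andbA; congr (_ && _); rewrite andbC.
Qed.

(** On words a split multiplies by X_a + X_b and a merge does nothing. Hence the two orders agree by
    commutativity, except when one saddle changes the kind of the other; then both orders perform
    one merge and one split, and the two factors coincide. *)
Lemma kh_square E E1 E2 E12 a b a' b' v w :
  equivr E -> equivr E1 -> equivr E2 -> equivr E12 ->
  cob E E1 a b -> cob E1 E12 a' b' -> cob E E2 a' b' -> cob E2 E12 a b ->
  saturated E v ->
  \sum_w' (kh E E1 a b v w' && kh E1 E12 a' b' w' w)%:R =
  \sum_w' (kh E E2 a' b' v w' && kh E2 E12 a b w' w)%:R :> F.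
Proof.
move=> eqE eqE1 eqE2 eqE12 c1 c1' c2 c2' /(saturated_word eqE)[s oks clv].
rewrite (kh_comp _ eqE eqE1 eqE12 c1 c1' oks clv) (kh_comp _ eqE eqE2 eqE12 c2 c2' oks clv).
have cP := cobP eqE eqE1 c1; have cP' := cobP eqE1 eqE12 c1'.
have cQ := cobP eqE eqE2 c2; have cQ' := cobP eqE2 eqE12 c2'.
have [_ x1] := c1; have [_ x1'] := c1'; have [_ x2] := c2; have [_ x2'] := c2'.
(* Merging only enlarges a relation. The implications [i1] to [i2'] discard the patterns of merges
   and splits that cannot occur. *)
have mono (F F' : rel T) x y p q : F' =2 addE F x y -> F p q ==> F' p q.
  by move=> ->; apply/implyP => Fpq; rewrite /addE Fpq.
have i1 : if E a b then E1 a' b' ==> E a' b' else E a' b' ==> E1 a' b'.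
  by move: cP; case: ifP => _ => [[H _]|H]; apply: mono H.
have i2 : if E a' b' then E2 a b ==> E a b else E a b ==> E2 a b.
  by move: cQ; case: ifP => _ => [[H _]|H]; apply: mono H.
have i1' : if E1 a' b' then E12 a b ==> E1 a b else E1 a b ==> E12 a b.
  by move: cP'; case: ifP => _ => [[H _]|H]; apply: mono H.
have i2' : if E2 a b then E12 a' b' ==> E2 a' b' else E2 a' b' ==> E12 a' b'.
  by move: cQ'; case: ifP => _ => [[H _]|H]; apply: mono H.
(* if [a ~ b] is created by identifying [a'] and [b'], then [{a, b}] and [{a', b'}]
   meet the same two classes, so they contribute the same sum of words *)
have pairs (G : rel T) x y x' y' t : equivr G -> ~~ G x y -> addE G x' y' x y ->
    (forall p q, G p q -> E12 p q) ->
    (ind E12 (x :: t) w)%:R + (ind E12 (y :: t) w)%:R =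
    (ind E12 (x' :: t) w)%:R + (ind E12 (y' :: t) w)%:R :> 'F_2.
  move=> [Gr Gs Gt] nxy; rewrite /addE (negPf nxy) /= => /andP[tx ty] G12.
  have same p q r : G p r -> G q r -> G p q by move=> pr qr; apply: Gt pr _; rewrite Gs.
  case/orP: tx => tx; case/orP: ty => ty.
  - by rewrite (same _ _ _ tx ty) in nxy.
  - by rewrite (ind_sim _ _ eqE12 (G12 _ _ tx)) (ind_sim _ _ eqE12 (G12 _ _ ty)).
  - by rewrite (ind_sim _ _ eqE12 (G12 _ _ tx)) (ind_sim _ _ eqE12 (G12 _ _ ty)) addrC.
  - by rewrite (same _ _ _ tx ty) in nxy.
move: x1 x1' x2 x2' cP cP' cQ cQ' i1 i2 i1' i2'; rewrite /words.
case ab: (E a b); case a'b': (E a' b'); case ab1: (E1 a' b'); case ab2: (E2 a b)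
  => x1 x1' x2 x2'; rewrite ?x1 ?x1' ?x2 ?x2' // => cP cP' cQ cQ' _ _ _ _;
  rewrite ?big_cons ?big_nil ?addr0 ?big_cons ?big_nil ?addr0 //.
- rewrite addrACA; congr (_ + _ + (_ + _)); congr (_%:R); congr nat_of_bool; exact: ind_swap.
- apply/esym/(pairs E1); rewrite ?ab1 //; first by rewrite -cP.1.
  by move=> p q; rewrite cP'; exact/implyP/(mono _ _ _ _ _ _ (fun _ _ => erefl)).
- apply/(pairs E12); rewrite ?x1' //; first by rewrite -cQ'.1 x2.
Qed.

(** The length of a word counts the circles labelled x; it grows by one in a split and is kept in a
    merge. *)
Lemma kh_labels (e e' : rel T) a b v w : connect_sym e -> connect_sym e' ->
  cob (connect e) (connect e') a b -> saturated (connect e) v ->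
  kh (connect e) (connect e') a b v w -> n_comp e' w = (n_comp e v + connect e a b)%N.
Proof.
move=> se se' cE; have eqE := equivr_connect se; have eqE' := equivr_connect se'.
move=> /(saturated_word eqE)[s oks <-] khw; rewrite (n_comp_cl se oks).
suff [t [okt -> sz]] : exists t, [/\ okw (connect e') t, w = cl (connect e') t &
    size t = (size s + connect e a b)%N] by rewrite (n_comp_cl se' okt).
have := cobP eqE eqE' cE; case: ifP => ab => [[EE nab]|EE].
  have := kh_split s w eqE eqE' EE nab; rewrite oks khw /=.
  case H: (ind _ (a :: s) w) => /= H'; last first.
    by move/esym/andP: H' => [ok /eqP wE]; exists (b :: s); split=> //=; rewrite addn1.
  by move/andP: H => [ok /eqP wE]; exists (a :: s); split=> //=; rewrite addn1.
have := kh_merge s w eqE eqE' EE (negbT ab); rewrite oks khw /= => /esym/andP[ok /eqP wE].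
by exists s; split=> //; rewrite addn0.
Qed.

Lemma n_comp_setT (e : rel T) : n_comp e T = n_comp e [set: T].
Proof. by apply: eq_card => x; rewrite !inE. Qed.

(** The labelling of all circles by x turns the count of labels into a count of circles. A split
    sends it to the same labelling, since S(x) is x tensor x; a merge is read backwards as a
    split. *)
Lemma cob_circles (e e' : rel T) a b : connect_sym e -> connect_sym e' ->
  cob (connect e) (connect e') a b ->
  (n_comp e T + connect e a b = n_comp e' T + connect e' a b)%N.
Proof.
move=> se se' [EE ab'].
have satT (r : rel T) : saturated r [set: T] by apply/saturatedP => x y; rewrite !inE.
have offT (P : pred T) : [forall d, P d ==> ((d \in [set: T]) == (d \in [set: T]))].
  by apply/forallP => d; rewrite eqxx implybT.
rewrite !n_comp_setT; case: (boolP (connect e a b)) => ab.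
  rewrite ab' ab addn0; apply/esym.
  rewrite (@kh_labels e e' a b setT setT) ?ab //.
  by rewrite /kh satT offT ab !inE.
rewrite ab' ab addn0 (@kh_labels e' e a b setT setT) ?ab' ?ab //.
  by split=> [x y|]; rewrite ?EE // ab' negbK.
by rewrite /kh satT offT ab' ab !inE.
Qed.

Lemma kh_degree (e e' : rel T) a b v w : connect_sym e -> connect_sym e' ->
  cob (connect e) (connect e') a b -> saturated (connect e) v ->
  kh (connect e) (connect e') a b v w ->
  (n_comp e' T)%:Z - 2 * (n_comp e' w)%:Z = (n_comp e T)%:Z - 2 * (n_comp e v)%:Z - 1.
Proof.
move=> se se' cE sv khw; rewrite (kh_labels se se' cE sv khw).
have := cob_circles se se' cE; have [_ ->] := cE.
by case: connect => /= circ; lia.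
Qed.
End Words.

(** * Resolutions of a tangle diagram *)

Lemma ord4P (P : 'I_4 -> Prop) : P q0 -> P q1 -> P q2 -> P q3 -> forall p, P p.
Proof.
move=> P0 P1 P2 P3 [[|[|[|[|//]]]] Hp].
- by rewrite (_ : Ordinal Hp = q0) //; apply: val_inj.
- by rewrite (_ : Ordinal Hp = q1) //; apply: val_inj.
- by rewrite (_ : Ordinal Hp = q2) //; apply: val_inj.
- by rewrite (_ : Ordinal Hp = q3) //; apply: val_inj.
Qed.

Fact euler_diagram n f c r e :
  (f = n + 1 + 2 * c -> r * 4 = 4 * n.+1 -> e * 2 = 4 * n.+1 -> f + r = e + 2 * c)%N.
Proof. by lia. Qed.

Section Tangle.
Variable T : tdiag.
Hypothesis diagT : is_tangle_diagram T.
Local Notation n := (ncr T).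
Local Notation D := (dart (ncr T)).
Implicit Types (d : D) (i : state T) (c : 'I_n) (k : bool).

Lemma edgeK : involutive (edge T).
Proof. by case/andP: diagT => /andP[/forallP eK _] _ d; apply/eqP. Qed.

Lemma edgeN d : edge T d != d.
Proof. by case/andP: diagT => /andP[_ /forallP eN] _. Qed.

Lemma rotv4 d : rotv (rotv (rotv (rotv d))) = d.
Proof.
case: d => [[c p]|b] /=; [congr (inl (_, _)); elim/ord4P: p|congr inr; elim/ord4P: b];
  exact: val_inj.
Qed.

Lemma rotv_inj : injective (@rotv T).
Proof. exact: (can_inj (g := fun d => rotv (rotv (rotv d))) rotv4). Qed.

Lemma order_rotv d : fingraph.order (@rotv T) d = 4%N.
Proof.
apply: (@order_cycle _ (@rotv T) [:: d; rotv d; rotv (rotv d); rotv (rotv (rotv d))]).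
- by rewrite /= !eqxx rotv4 eqxx.
- by case: d => [[c p]|b]; rewrite /= !inE; [elim/ord4P: p|elim/ord4P: b];
    rewrite ?(inj_eq (@inl_inj _ _)) ?xpair_eqE ?eqxx.
- exact: mem_head.
Qed.

Lemma order_edge d : fingraph.order (edge T) d = 2.
Proof.
apply: (@order_cycle _ (edge T) [:: d; edge T d]).
- by rewrite /= !eqxx edgeK eqxx.
- by rewrite /= inE eq_sym edgeN.
- exact: mem_head.
Qed.

(** The outside of the disk is one more four-valent vertex, so there are four darts at each of
    [n.+1] vertices. *)
Lemma fcard_order (f : D -> D) m : injective f -> (forall d, fingraph.order f d = m) ->
  (fcard f predT * m = 4 * n.+1)%N.
Proof.
move=> injf ordf; rewrite (@fcard_order_set _ _ injf m).
- by rewrite card_sum card_prod !card_ord; lia.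
- by apply/subsetP => d _; rewrite inE ordf.
- by move=> d d'; rewrite !inE.
Qed.

Lemma tangle_checkerboard : exists chi : D -> bool,
  (forall d, chi (edge T d) = ~~ chi d) /\ (forall d, chi (rotv d) = ~~ chi d).
Proof.
case/andP: (diagT) => _ /eqP euler.
apply: (@checkerboard _ (edge T) (@rotv T) (@graph_rel T)).
- exact: edgeK.
- exact: edgeN.
- exact: rotv_inj.
- exact: order_rotv.
- move=> x y; rewrite /graph_rel -(inv_eq edgeK) (eq_sym (edge T y)) eq_sym -!orbA; congr (_ || _).
  by rewrite orbC.
- move=> f fe fr x y /orP[/orP[]|] /eqP ->; by rewrite ?fe ?fr.
- have := fcard_order (inv_inj edgeK) order_edge; have := fcard_order rotv_inj order_rotv.
  move: euler; rewrite -[fcard (@facep T) _]/(fcard (@rotv T \o edge T) predT).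
  exact: euler_diagram.
Qed.

Lemma smoothCK k i : involutive (smoothC k i).
Proof.
case=> [[c p]|b] /=; [case: (i c); congr (inl (_, _)); elim/ord4P: p|
  case: k; congr inr; elim/ord4P: b]; exact: val_inj.
Qed.

Lemma smoothK i : involutive (smooth i).
Proof. by case=> [[c p]|b] //=; case: (i c); congr (inl (_, _)); elim/ord4P: p; exact: val_inj. Qed.

Section Colouring.
Variable chi : D -> bool.
Hypotheses (chi_e : forall d, chi (edge T d) = ~~ chi d)
           (chi_r : forall d, chi (rotv d) = ~~ chi d).

Lemma chi_inl c p : chi (inl (c, p)) = odd p (+) chi (inl (c, q0)).
Proof.
have S p' : chi (inl (c, p' + 1)) = ~~ chi (inl (c, p')) by exact: (chi_r (inl (c, p'))).
have r1 : q0 + 1 = q1 by apply: val_inj.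
have r2 : q1 + 1 = q2 by apply: val_inj.
have r3 : q2 + 1 = q3 by apply: val_inj.
by elim/ord4P: p => //=; rewrite -?r3 ?S -?r2 ?S -?r1 ?S ?negbK.
Qed.

Lemma chi_inr b : chi (inr b) = odd b (+) chi (inr q0).
Proof.
have S p' : chi (inr (p' - 1)) = ~~ chi (inr p') by exact: (chi_r (inr p')).
have r1 : q0 - 1 = q3 by apply: val_inj.
have r2 : q3 - 1 = q2 by apply: val_inj.
have r3 : q2 - 1 = q1 by apply: val_inj.
by elim/ord4P: b => //=; rewrite -?r3 ?S -?r2 ?S -?r1 ?S ?negbK.
Qed.

(** Both smoothings join neighbouring half-edges, whose indices have opposite parity. *)
Lemma chi_smooth i c p : chi (smooth i (inl (c, p))) = ~~ chi (inl (c, p)).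
Proof.
rewrite /= chi_inl [chi (inl (c, p))]chi_inl.
by case: (i c); elim/ord4P: p; rewrite //= negbK.
Qed.

Lemma chi_smoothC k i d : chi (smoothC k i d) = ~~ chi d.
Proof.
case: d => [[c p]|b]; first exact: chi_smooth.
by rewrite /= chi_inr [chi (inr b)]chi_inr; case: k; elim/ord4P: b; rewrite //= negbK.
Qed.
End Colouring.

End Tangle.

(** * Arcs and circles of open and closed resolutions *)

Section Resolutions.
Variable T : tdiag.
Hypothesis diagT : is_tangle_diagram T.
Local Notation n := (ncr T).
Local Notation D := (dart (ncr T)).
Implicit Types (d : D) (i : state T) (c : 'I_n) (k : bool).

Local Notation edgeK := (edgeK diagT).

Definition upd i c : state T := [ffun c' => if c' == c then true else i c'].

Lemma adjR_csym i : connect_sym (adjR i).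
Proof. exact: adj_csym edgeK (smoothK i). Qed.

Lemma adjC_csym k i : connect_sym (adjC k i).
Proof. exact: adj_csym edgeK (smoothCK k i). Qed.

Lemma inlN c p d : d \notin [:: inl (c, q0); inl (c, q1); inl (c, q2); inl (c, q3)] ->
  d != inl (c, p) :> D.
Proof. by apply: contraNneq => ->; rewrite !inE; elim/ord4P: p; rewrite eqxx ?orbT. Qed.

Lemma smooth_upd i c d : d \notin [:: inl (c, q0); inl (c, q1); inl (c, q2); inl (c, q3)] ->
  smooth (upd i c) d = smooth i d.
Proof.
case: d => [[c' p]|//] /(inlN p) /=; rewrite ffunE; case: (c' =P c) => // ->.
by rewrite eqxx.
Qed.

Lemma smooth0 i c : i c = false -> (smooth i (inl (c, q0)) = inl (c, q1)) *
  (smooth i (inl (c, q2)) = inl (c, q3)).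
Proof. by move=> ic; split; rewrite /= ic; congr (inl (_, _)); apply: val_inj. Qed.

Lemma smooth1 i c : (smooth (upd i c) (inl (c, q0)) = inl (c, q3)) *
  (smooth (upd i c) (inl (c, q2)) = inl (c, q1)).
Proof. by split; rewrite /= ffunE eqxx; congr (inl (_, _)); apply: val_inj. Qed.

(** An open resolution need not satisfy the exclusive alternative of [cob]: [smooth] fixes the
    boundary points, and a saddle between the two arcs leaves its ends on different arcs. *)
Lemma addE_adjR i c : i c = false ->
  addE (connect (adjR i)) (dA c) (dB c) =2 addE (connect (adjR (upd i c))) (dA c) (dB c).
Proof.
move=> ic.
apply: (@addE_resmooth _ (edge T) (smooth i) (smooth (upd i c)) _ (inl (c, q1)) _ (inl (c, q3))).
- exact: edgeK.
- exact: smoothK.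
- exact: smoothK.
- by rewrite smooth0.
- by rewrite smooth0.
- by rewrite smooth1.
- by rewrite smooth1.
- exact: smooth_upd.
Qed.

Lemma cob_adjC k i c : i c = false ->
  cob (connect (adjC k i)) (connect (adjC k (upd i c))) (dA c) (dB c).
Proof.
move=> ic; have upd_out d : d \notin [:: inl (c, q0); inl (c, q1); inl (c, q2); inl (c, q3)] ->
    smoothC k (upd i c) d = smoothC k i d.
  by case: d => [[c' p]|//] /smooth_upd; apply.
have s0 : smoothC k i (dA c) = inl (c, q1) := (smooth0 ic).1.
have s2 : smoothC k i (dB c) = inl (c, q3) := (smooth0 ic).2.
have s'0 : smoothC k (upd i c) (dA c) = inl (c, q3) := (smooth1 i c).1.
have s'2 : smoothC k (upd i c) (dB c) = inl (c, q1) := (smooth1 i c).2.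
have [chi [chi_e chi_r]] := tangle_checkerboard diagT.
have chi_s j := chi_smoothC chi_r k j.
have chi02 : chi (dA c) = chi (dB c) by rewrite (chi_inl chi_r) /= [RHS](chi_inl chi_r).
have AB : dA c != dB c by rewrite (inj_eq (@inl_inj _ _)) xpair_eqE eqxx.
split.
  refine (addE_resmooth edgeK (smoothCK k i) (smoothCK k (upd i c)) s0 s2 s'0 s'2 upd_out).
exact: (resmooth_xor edgeK (smoothCK k i) (smoothCK k (upd i c)) chi_e (chi_s _) (chi_s _)
  s0 s2 s'0 s'2 upd_out AB chi02).
Qed.

(** The closures by T_0 and T_1 are the two smoothings of the outer vertex. *)
Lemma boundary_xor i : connect (adjC true i) (inr q0) (inr q2) =
  ~~ connect (adjC false i) (inr q0) (inr q2).
Proof.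
have [chi [chi_e chi_r]] := tangle_checkerboard diagT.
have chi_s k := chi_smoothC chi_r k i.
have eqb (b b' : 'I_4) : b = b' -> inr b = inr b' :> D by move->.
apply: (resmooth_xor edgeK (smoothCK false i) (smoothCK true i) chi_e (chi_s _) (chi_s _)
  (p1 := inr q3) (p3 := inr q1)) => //=; try by apply: eqb; apply: val_inj.
- case=> [[c p]|b] //; by elim/ord4P: b; rewrite !inE eqxx ?orbT.
- by rewrite [RHS](chi_inr chi_r).
Qed.

(** Points are given signs by colour and summed over the component of [d]. Edges reverse the sign,
    so the sum is 0. Pairs joined by [smooth] at crossings cancel, so the boundary points of the
    component also have signed sum 0, and their signs alternate with their index. *)
Lemma arc_ends i d :
  (connect (adjR i) d (inr q0) + connect (adjR i) d (inr q2) =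
   connect (adjR i) d (inr q1) + connect (adjR i) d (inr q3))%N.
Proof.
have [chi [chi_e chi_r]] := tangle_checkerboard diagT.
pose sg d' : int := if chi d' then 1 else -1.
pose S (f : D -> D) := \sum_(d' | connect (adjR i) d d') sg (f d').
have S_eq (f : D -> D) : involutive f -> (forall x, connect (adjR i) x (f x)) -> S f = S id.
  move=> fK f_conn; rewrite /S [RHS](reindex_inj (inv_inj fK)) /=; apply: eq_bigl => x.
  apply/idP/idP => dx; apply: connect_trans dx _; first exact: f_conn.
  by rewrite (adjR_csym i) f_conn.
have SE : S id = 0.
  have := S_eq _ edgeK (connect_adj_e (edge T) (smooth i)).
  have -> : S (edge T) = - S id.
    rewrite /S -sumrN; apply: eq_bigr => x _; rewrite /sg chi_e /=.
    by case: (chi x).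
  by lia.
have : S id + S (smooth i) = 0.
  by rewrite (S_eq _ (smoothK i) (connect_adj_s (edge T) (smooth i))) SE.
rewrite /S -big_split big_sumType /= big1 => [|[c p] _]; last first.
  by rewrite /sg (chi_smooth chi_r) /=; case: (chi _).
rewrite add0r big_mkcond !big_ord_recl big_ord0 /=.
have <- : q0 = ord0 by apply: val_inj.
have -> : lift q0 ord0 = q1 by apply: val_inj.
have -> : lift q0 (lift ord0 ord0) = q2 by apply: val_inj.
have -> : lift q0 (lift ord0 (lift ord0 ord0)) = q3 by apply: val_inj.
rewrite /sg (chi_inr chi_r q1) (chi_inr chi_r q2) (chi_inr chi_r q3) /=.
by move=> /eqP; do 4!case: connect; case: (chi _).
Qed.

Record arcs_spec i : Prop := ArcsSpec {
  arc01 : connect (adjR i) (inr q0) (inr q1) = ell i;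
  arc02 : connect (adjR i) (inr q0) (inr q2) = false;
  arc03 : connect (adjR i) (inr q0) (inr q3) = ~~ ell i;
  arc21 : connect (adjR i) (inr q2) (inr q1) = ~~ ell i;
  arc23 : connect (adjR i) (inr q2) (inr q3) = ell i }.

Lemma adjR_sub_adjC k i d d' : connect (adjR i) d d' -> connect (adjC k i) d d'.
Proof.
apply: connect_sub => {d d'} d d' /orP[]/eqP->; first exact: connect_adj_e.
case: d => [[c p]|b]; last exact: connect0.
exact: (connect_adj_s (edge T) (smoothC k i)).
Qed.

Lemma connectC_tpart k i b : connect (adjC k i) (inr b) (inr (tpart k b)).
Proof. exact: (connect_adj_s (edge T) (smoothC k i) (inr b)). Qed.

(** The points [q0] and [q2] lie on different arcs, since otherwise they would be connected in both
    closures. By [arc_ends] each of them is then joined to exactly one of [q1] and [q3]. *)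
Lemma arcsP i : arcs_spec i.
Proof.
have s := adjR_csym i.
have n02 : connect (adjR i) (inr q0) (inr q2) = false.
  apply/negbTE/negP => c02; move: (boundary_xor i).
  by rewrite !adjR_sub_adjC.
have meet b : connect (adjR i) (inr q0) (inr b) -> connect (adjR i) (inr q2) (inr b) = false.
  move=> c0b; apply/negP => c2b; move/negP: n02; apply.
  by apply: connect_trans c0b _; rewrite s.
have := arc_ends i (inr q0); have := arc_ends i (inr q2); have m1 := meet q1; have m3 := meet q3.
rewrite !connect0 s n02 => e2 e0.
split; rewrite // /ell; move: m1 m3 e0 e2.
all: case: (connect _ (inr q0) (inr q1)); case: (connect _ (inr q0) (inr q3)) => //=.
all: case: (connect _ (inr q2) (inr q1)); case: (connect _ (inr q2) (inr q3)) => //=.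
all: try (by move=> m1 m3; discriminate (m1 isT)); try (by move=> m1 m3; discriminate (m3 isT)).
Qed.

Lemma onarcE i d : onarc i d = connect (adjR i) d (inr q0) || connect (adjR i) d (inr q2).
Proof.
have [r01 _ r03 r21 r23] := arcsP i; have t := @connect_trans _ (adjR i).
apply/existsP/orP => [[b db]|[] db]; [|by exists q0|by exists q2].
elim/ord4P: b db => db; [by left| |by right|].
  by case l: (ell i); [left|right]; apply: t db _; rewrite (adjR_csym i) ?r01 ?r21 l.
by case l: (ell i); [right|left]; apply: t db _; rewrite (adjR_csym i) ?r03 ?r23 l.
Qed.

Lemma onarc_sim i d d' : connect (adjR i) d d' -> onarc i d = onarc i d'.
Proof. by move=> dd'; rewrite !onarcE !(same_connect (adjR_csym i) dd'). Qed.

Lemma onarc_inr i b : onarc i (inr b).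
Proof. by apply/existsP; exists b; apply: connect0. Qed.

(** Closing by T_k joins the ends of each arc separately when the resolution has type [k], and
    otherwise joins the two arcs into one circle. *)
Lemma connectC k i d d' : connect (adjC k i) d d' =
  connect (adjR i) d d' || [&& ell i != k, onarc i d & onarc i d'].
Proof.
have [r01 r02 r03 r21 r23] := arcsP i; have s := adjR_csym i.
apply/idP/orP => [|[|/and3P[lk]]]; last 2 first.
- exact: adjR_sub_adjC.
- have c02 : connect (adjC k i) (inr q0) (inr q2).
    have sC := adjC_csym k i; have t := @connect_trans _ (adjC k i).
    have := connectC_tpart k i q2; move: lk; case l: (ell i); case: k sC t => //= sC t _.
      rewrite (_ : 3 - q2 = q1); last exact: val_inj.
      by rewrite sC; apply: t; apply: adjR_sub_adjC; rewrite r01 l.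
    rewrite (_ : q2 + 1 = q3); last exact: val_inj.
    by rewrite sC; apply: t; apply: adjR_sub_adjC; rewrite r03 l.
  have to0 x : onarc i x -> connect (adjC k i) x (inr q0).
    rewrite onarcE => /orP[] /(adjR_sub_adjC k) // x2; apply: connect_trans x2 _.
    by rewrite (adjC_csym k i).
  by move=> /to0 d0 /to0 d0'; apply: connect_trans d0 _; rewrite (adjC_csym k i).
pose Q x := connect (adjR i) d x || [&& ell i != k, onarc i d & onarc i x].
move=> dd'; apply/orP; apply: (connect_ind (Q := Q) _ dd'); last by rewrite /Q connect0.
move=> {dd'} x y xy; suff : connect (adjR i) x y || [&& ell i != k, onarc i x & onarc i y].
  case/orP => [cxy|/and3P[lk ox oy]].
    rewrite /Q (onarc_sim cxy) => /orP[dx|->]; last by rewrite orbT.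
    by rewrite (connect_trans dx cxy).
  by rewrite /Q lk oy andbT => /orP[/onarc_sim ->|/and3P[_ -> _]]; rewrite ?ox orbT.
case/orP: xy => /eqP->; first by rewrite connect_adj_e.
case: x => [[c p]|b]; first by rewrite (connect_adj_s (edge T) (smooth i)).
rewrite /= !onarc_inr !andbT; case: (ell i =P k) => [<-|]; rewrite ?orbT // orbF.
case l: (ell i); rewrite l in r01 r03 r21 r23; elim/ord4P: b => /=.
- by rewrite (_ : q0 + 1 = q1) ?r01 //; exact: val_inj.
- by rewrite (_ : q1 - 1 = q0) 1?s ?r01 //; exact: val_inj.
- by rewrite (_ : q2 + 1 = q3) ?r23 //; exact: val_inj.
- by rewrite (_ : q3 - 1 = q2) 1?s ?r23 //; exact: val_inj.
- by rewrite (_ : 3 - q0 = q3) ?r03 //; exact: val_inj.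
- by rewrite (_ : 3 - q1 = q2) 1?s ?r21 //; exact: val_inj.
- by rewrite (_ : 3 - q2 = q1) ?r21 //; exact: val_inj.
- by rewrite (_ : 3 - q3 = q0) 1?s ?r03 //; exact: val_inj.
Qed.
End Resolutions.

(** * Comparison of the differentials *)

(** The label of the closed circle through [q2]. For gamma and tau this is the marked circle, hence
    labelled x. *)
Definition xbit (y : Gen) : bool :=
  match y with g_alpha | g_rho => false | _ => true end.

Definition xgen (k l x : bool) : Gen :=
  if l == k then
    if k then (if x then g_sigma else g_rho) else (if x then g_beta else g_alpha)
  else if k then g_tau else g_gamma.

Definition xorsum (I : Type) (s : seq I) (P : I -> bool) : bool :=
  foldr (fun u acc => P u (+) acc) false s.

Lemma eq_xorsum (I : Type) (s : seq I) (P Q : I -> bool) : P =1 Q -> xorsum s P = xorsum s Q.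
Proof. by move=> PQ; elim: s => //= u s ->; rewrite PQ. Qed.

Lemma sum_natr_xor (I : Type) (s : seq I) (P : I -> bool) :
  \sum_(u <- s) (P u)%:R = (xorsum s P)%:R :> F.
Proof.
elim: s => [|u s IH]; first by rewrite big_nil.
by rewrite big_cons IH /= natr_addb.
Qed.

(* [a0] = "[A] lies on the earringed arc", [a2] = "[A] lies on the other arc",
   [ab] = "[A] and [B] are connected"; primes refer to the target resolution *)
Definition kcase_bool (l a0 a2 b0 b2 ab a0' a2' b0' b2' Av Bv Aw Bw : bool) (u : LGen) : bool :=
  let aL := if l then l_a1 else l_a0 in
  let cL := if l then l_c1 else l_c0 in
  if ~~ (a0 || a2) && ~~ (b0 || b2) then
    (if ~~ ab then (u == aL) && ~~ (Av && Bv) && (Aw == Av || Bv)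
     else (u == aL) && (if Av then Aw && Bw else Aw != Bw))
  else if ~~ ab then
    (if (a0 || a2) && (b0 || b2) then u == (if l then l_p01 else l_q10)
     else let Cv := if a0 || a2 then Bv else Av in
       if (if a0 || a2 then a0 else b0) then (u == aL) && ~~ Cv
       else ((u == aL) && ~~ Cv) || ((u == cL) && Cv))
  else let Cw := if a0' || a2' then Bw else Aw in
    if (if a0' || a2' then a0' else b0') then (u == aL) && Cw
    else ((u == aL) && Cw) || ((u == cL) && ~~ Cw).

Definition khcase_bool (cab Av Bv Aw Bw : bool) : bool :=
  if cab then (if Av then Aw && Bw else Aw != Bw)
  else ~~ (Av && Bv) && (Aw == Av || Bv).

(** The constraints on the bits that come from one resolution: its two arcs are distinct, connected
    points share all their bits, and labelled circles avoid the arcs. *)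
Definition class_bool (a0 a2 b0 b2 ab Av Bv : bool) : bool :=
  [&& ~~ (a0 && a2), ~~ (b0 && b2),
      (if ab then [&& a0 == b0, a2 == b2 & Av == Bv] else ~~ (a0 && b0) && ~~ (a2 && b2)),
      Av ==> ~~ (a0 || a2) & Bv ==> ~~ (b0 || b2)].

(** A finite check over all positions of a saddle relative to the two arcs. The hypotheses leave
    only geometric patterns: a saddle touches the same arcs before and after, the type changes only
    if it touches both, and in each of the two closures it is a merge or a split. *)
Lemma mu2_khovanov k l l' y z a0 a2 b0 b2 ab a0' a2' b0' b2' ab' Av Bv Aw Bw :
  let C kk := ab || [&& l != kk, a0 || a2 & b0 || b2] in
  let C' kk := ab' || [&& l' != kk, a0' || a2' & b0' || b2'] in
  gen_ok k l y -> gen_ok k l' z ->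
  class_bool a0 a2 b0 b2 ab Av Bv -> class_bool a0' a2' b0' b2' ab' Aw Bw ->
  a0 || b0 = a0' || b0' -> a2 || b2 = a2' || b2' ->
  (~~ (a0 || b0) || ~~ (a2 || b2) ==> (l' == l)) ->
  C' false = ~~ C false -> C' true = ~~ C true ->
  xorsum lgens (fun u =>
    kcase_bool l a0 a2 b0 b2 ab a0' a2' b0' b2' Av Bv Aw Bw u && (mu2 u y == Some z)) =
  (a2 || b2 || (xbit y == xbit z)) &&
  khcase_bool (C k) [|| Av, a0 | xbit y && a2] [|| Bv, b0 | xbit y && b2]
                    [|| Aw, a0' | xbit z && a2'] [|| Bw, b0' | xbit z && b2'].
Proof.
case: k; case: l; case: l' => /=.
all: case: y => //=; case: z => //= _ _.
all: case: a0; case: a2 => //; case: b0; case: b2 => //; case: ab => //.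
all: case: a0'; case: a2' => //; case: b0'; case: b2' => //; case: ab' => //.
all: by case: Av; case: Bv => //; case: Aw; case: Bw.
Qed.

Section Comparison.
Variable T : tdiag.
Hypothesis diagT : is_tangle_diagram T.
Local Notation n := (ncr T).
Local Notation D := (dart (ncr T)).
Implicit Types (d : D) (i : state T) (c : 'I_n) (k : bool) (v w : {set D}).

Definition closeup i v (x : bool) : {set D} :=
  [set d | [|| d \in v, connect (adjR i) d (inr q0) | x && connect (adjR i) d (inr q2)]].

Lemma labKP i v : reflect
  ((forall d d', connect (adjR i) d d' -> (d \in v) = (d' \in v)) /\
   (forall d, d \in v -> onarc i d = false)) (labK i v).
Proof.
apply: (iffP andP) => [[/saturatedP sat /forallP off]|[sat off]].
  by split=> // d dv; apply/negbTE/(implyP (off d)).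
by split; [apply/saturatedP|apply/forallP => d; apply/implyP => /off ->].
Qed.

Section Step.
Variables (k : bool) (i : state T) (c : 'I_n).
Hypothesis ic : i c = false.
Local Notation j := (upd i c).
Local Notation A := (dA c).
Local Notation B := (dB c).
Local Notation R := (connect (adjR i)).
Local Notation R' := (connect (adjR j)).

Definition touched i d := connect (adjR i) d (dA c) || connect (adjR i) d (dB c).

Lemma touched_upd d : touched i d = touched j d.
Proof.
have := addE_adjR diagT ic d A; rewrite /addE !connect0 /= !andbT.
by rewrite /touched; case: connect; case: connect; case: connect; case: connect.
Qed.

Lemma untouched_upd d d' : ~~ touched i d -> R d d' = R' d d'.
Proof.
move=> ntd; have := addE_adjR diagT ic d d'; rewrite /addE.
rewrite -!/(touched _ _) -touched_upd (negPf ntd) /=.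
by rewrite !orbF.
Qed.

Lemma touched_sim d d' : R d d' -> touched i d = touched i d'.
Proof. by move=> dd'; rewrite /touched !(same_connect (adjR_csym diagT i) dd'). Qed.

Lemma ell_upd b : b = q0 \/ b = q2 -> ~~ touched i (inr b) -> ell j = ell i.
Proof.
have [r01 _ _ r21 _] := arcsP diagT i; have [r01' _ _ r21' _] := arcsP diagT j.
case=> -> nt; first by rewrite -r01 -r01' untouched_upd.
by apply: negb_inj; rewrite -r21 -r21' untouched_upd.
Qed.

Variables (v w : {set D}) (y z : Gen).
Hypotheses (lv : labK i v) (lw : labK j w).
Hypotheses (gy : gen_ok k (ell i) y) (gz : gen_ok k (ell j) z).

Let V := closeup i v (xbit y).
Let W := closeup j w (xbit z).

Lemma xbit_gen l g : gen_ok k l g -> l != k -> xbit g.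
Proof. by case: k; case: l; case: g. Qed.

(** Away from the saddle, the closed labellings carry one bit more than the open ones: the label of
    the circle through [q2]. *)
Lemma agree_off :
  [forall d, ~~ (connect (adjC k i) d A || connect (adjC k i) d B) ==> ((d \in V) == (d \in W))] =
  [forall d, ~~ (R d A || R d B) ==> ((d \in v) == (d \in w))] &&
  ((R A (inr q2) || R B (inr q2)) || (xbit y == xbit z)).
Proof.
have [satv offv] := labKP i v lv; have [satw offw] := labKP j w lw.
have Rs := adjR_csym diagT i.
have [_ r02 _ _ _] := arcsP diagT i.
have -> : R A (inr q2) || R B (inr q2) = touched i (inr q2) by rewrite /touched !(Rs (inr q2)).
have onarc_upd d : ~~ touched i d -> onarc j d = onarc i d.
  by move=> ntd; rewrite !onarcE // !(untouched_upd _ ntd).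
apply/forallP/andP => [h|[/forallP h bits] d].
  split.
    apply/forallP => d; apply/implyP => ntd.
    have [od|nod] := boolP (onarc i d).
      have -> : d \in v = false by apply/negP => /offv; rewrite od.
      have -> : d \in w = false by apply/negP => /offw; rewrite onarc_upd // od.
      by [].
    have := h d; rewrite !connectC // (negPf nod) !andbF !orbF ntd /=.
    rewrite !inE -!(untouched_upd _ ntd); move: nod.
    by rewrite onarcE // negb_or => /andP[/negPf-> /negPf->]; rewrite !andbF !orbF.
  case: (boolP (touched i (inr q2))) => //= nt2.
  case: (boolP (connect (adjC k i) (inr q2) A || connect (adjC k i) (inr q2) B)) => [tC|ntC].
    (* The saddle reaches [q2] only through the closing arcs, so the arcs are joined there. It
       misses the arc of [q2], so the type is unchanged, and both generators are forced to carry the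
       label x. *)
    have lk : ell i != k.
      by apply: contraTneq tC => lk; rewrite !connectC // lk eqxx /= !orbF.
    by rewrite (xbit_gen gy lk) (xbit_gen gz) // (@ell_upd q2) //; right.
  have := h (inr q2); rewrite ntC /= !inE -!(untouched_upd _ nt2) (Rs (inr q2)) r02 connect0 !andbT /=.
  have -> : inr q2 \in v = false by apply/negP => /offv; rewrite onarc_inr.
  by have -> : inr q2 \in w = false by apply/negP => /offw; rewrite onarc_inr.
apply/implyP => ntC; have ntd : ~~ touched i d.
  by apply: contra ntC; rewrite /touched !connectC // => /orP[]->; rewrite ?orbT.
rewrite !inE -!(untouched_upd _ ntd) (eqP (implyP (h d) ntd)).
case: (boolP (R d (inr q2))) => [d2|]; last by rewrite !andbF.
by move: bits; rewrite -(touched_sim d2) (negPf ntd) /= => /eqP ->.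
Qed.

Lemma kcase_khcase :
  xorsum lgens (fun u => [&& [forall d, ~~ (R d A || R d B) ==> ((d \in v) == (d \in w))],
    kcase i j c u v w & mu2 u y == Some z]) =
  [forall d, ~~ (connect (adjC k i) d A || connect (adjC k i) d B) ==> ((d \in V) == (d \in W))]
    && khcase k i c V W.
Proof.
have [satv offv] := labKP i v lv; have [satw offw] := labKP j w lw.
have Rs := adjR_csym diagT i; have Rs' := adjR_csym diagT j.
rewrite agree_off; case: [forall d, _]; last by rewrite andFb; elim: lgens => //= u s ->.
rewrite andTb.
have classb (e : rel D) (u : {set D}) : connect_sym e -> connect e (inr q0) (inr q2) = false ->
    (forall d d', connect e d d' -> (d \in u) = (d' \in u)) ->
    (forall d, d \in u -> connect e d (inr q0) || connect e d (inr q2) = false) ->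
    class_bool (connect e A (inr q0)) (connect e A (inr q2)) (connect e B (inr q0))
      (connect e B (inr q2)) (connect e A B) (A \in u) (B \in u).
  move=> es e02 satu offu; rewrite /class_bool.
  have dis x : connect e x (inr q0) && connect e x (inr q2) = false.
    by apply/negP => /andP[x0 x2]; move/negP: e02; apply; apply: connect_trans x2; rewrite es.
  rewrite !dis /=; apply/and3P; split; try by apply/implyP => /offu ->.
  case: ifP => AB; first by rewrite !(same_connect es AB) (satu _ _ AB) !eqxx.
  have nAB x : connect e A x && connect e B x = false.
    by apply/negP => /andP[Ax Bx]; move/negP: AB; apply; apply: connect_trans Ax _; rewrite es.
  by rewrite !nAB.
have [_ r02 _ _ _] := arcsP diagT i; have [_ r02' _ _ _] := arcsP diagT j.
have touch b : R A (inr b) || R B (inr b) = R' A (inr b) || R' B (inr b).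
  by rewrite !(Rs _ (inr b)) !(Rs' _ (inr b)); exact: touched_upd.
have xorC kk := (cob_adjC diagT kk ic).2.
have ellj : ~~ (R A (inr q0) || R B (inr q0)) || ~~ (R A (inr q2) || R B (inr q2)) ==>
    (ell j == ell i).
  rewrite !(Rs _ (inr q0)) !(Rs _ (inr q2)).
  by apply/implyP => /orP[] /ell_upd ->; rewrite ?eqxx //; [left|right].
have offv' d : d \in v -> R d (inr q0) || R d (inr q2) = false by move/offv; rewrite onarcE.
have offw' d : d \in w -> R' d (inr q0) || R' d (inr q2) = false by move/offw; rewrite onarcE.
have CE kk : connect (adjC kk i) A B = R A B || [&& ell i != kk, R A (inr q0) || R A (inr q2)
    & R B (inr q0) || R B (inr q2)] by rewrite connectC // !onarcE.
have CE' kk : connect (adjC kk j) A B = R' A B || [&& ell j != kk, R' A (inr q0) || R' A (inr q2)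
    & R' B (inr q0) || R' B (inr q2)] by rewrite connectC // !onarcE.
have xf := xorC false; have xt := xorC true; rewrite !CE !CE' in xf xt.
have := mu2_khovanov gy gz (classb _ _ Rs r02 satv offv') (classb _ _ Rs' r02' satw offw')
  (touch q0) (touch q2) ellj xf xt.
rewrite -CE -!/(_ \in _) => H; rewrite /khcase !in_set -H.
apply: eq_xorsum => u; rewrite andTb; congr (_ && _); rewrite /kcase /kcase_bool /earr !onarcE //.
case: ifP => // _; case: (R A B) => /=.
  by case: (R' A _ || R' A _).
by case: (R A _ || R A _).
Qed.
End Step.
End Comparison.

(** * Homology *)

Section Transport.
Variables (B B' : finType) (Dm : B -> B -> F) (Dm' : B' -> B' -> F).

Definition dfun (C : finType) (M : C -> C -> F) (f : VB C) : VB C :=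
  [ffun c => \sum_b (f b : F) * M b c].

Fact dfun_linear (C : finType) (M : C -> C -> F) : linear (@dfun C M).
Proof.
move=> a f g; apply/ffunP => c; rewrite !ffunE scaler_sumr -big_split /=.
by apply: eq_bigr => b _; rewrite !ffunE mulrDl scalerAl.
Qed.
HB.instance Definition _ (C : finType) (M : C -> C -> F) :=
  GRing.isLinear.Build F (VB C) (VB C) _ (@dfun C M) (@dfun_linear C M).

Lemma dlinE (C : finType) (M : C -> C -> F) f : dlin M f = dfun M f.
Proof. exact: (lfunE (@dfun C M)). Qed.

Variables (phi : B -> B') (psi : B' -> B).
Hypotheses (phiK : cancel phi psi) (psiK : cancel psi phi).
Hypothesis DmE : forall b b', Dm b b' = Dm' (phi b) (phi b').

Definition relabel (f : VB B) : VB B' := [ffun c => f (psi c)].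
Fact relabel_linear : linear relabel.
Proof. by move=> a f g; apply/ffunP => c; rewrite !ffunE. Qed.
HB.instance Definition _ := GRing.isLinear.Build F (VB B) (VB B') _ relabel relabel_linear.
Let L := linfun relabel.

Lemma lker_relabel : lker L = 0%VS.
Proof.
apply/eqP; rewrite -subv0; apply/subvP => f; rewrite memv_ker lfunE memv0 => /eqP Lf.
apply/eqP/ffunP => b; have /ffunP/(_ (phi b)) := Lf.
by rewrite !ffunE phiK.
Qed.

Lemma relabel_dlin f : L (dlin Dm f) = dlin Dm' (L f).
Proof.
rewrite !dlinE !lfunE; apply/ffunP => c; rewrite !ffunE.
rewrite (reindex psi) /=; last by exists phi => x _; rewrite ?phiK ?psiK.
by apply: eq_bigr => b _; rewrite !ffunE DmE !psiK.
Qed.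

Lemma relabel_gsub (gr : B -> int * int) (gr' : B' -> int * int) x x' :
  (forall b, (gr b == x) = (gr' (phi b) == x')) -> (L @: gsub gr x)%VS = gsub gr' x'.
Proof.
move=> grE; rewrite limg_span; apply: eq_span => f.
have ind b : L [ffun c => ((c == b)%:R : F)] = [ffun c => ((c == phi b)%:R : F)].
  by rewrite lfunE; apply/ffunP => c; rewrite !ffunE (can2_eq psiK phiK).
apply/mapP/mapP => [[_ /mapP[b bx ->] ->]|[b bx ->]].
  exists (phi b); last exact: ind.
  by move: bx; rewrite !(mem_filter _ _ (enum _)) !mem_enum -grE.
exists ([ffun c => ((c == psi b)%:R : F)] : VB B); last by rewrite ind psiK.
apply/mapP; exists (psi b) => //.
by move: bx; rewrite !(mem_filter _ _ (enum _)) !mem_enum grE psiK.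
Qed.

(** The relabelling is injective and commutes with the differentials, so it carries cycles to cycles
    and boundaries to boundaries; only the degrees [x] and [x - dx] have to be matched. *)
Lemma homdim_relabel (gr : B -> int * int) (gr' : B' -> int * int) x dx x' dx' :
  (forall b, (gr b == x) = (gr' (phi b) == x')) ->
  (forall b, (gr b == (x.1 - dx.1, x.2 - dx.2)) = (gr' (phi b) == (x'.1 - dx'.1, x'.2 - dx'.2))) ->
  homdim Dm gr x dx = homdim Dm' gr' x' dx'.
Proof.
move=> gx gp; rewrite /homdim.
have dimL (U : {vspace VB B}) : \dim (L @: U) = \dim U.
  by rewrite limg_dim_eq // lker_relabel capv0.
have cyc : (L @: (gsub gr x :&: lker (dlin Dm)) = gsub gr' x' :&: lker (dlin Dm'))%VS.
  rewrite -(relabel_gsub gx); apply: subv_anti; apply/andP; split; apply/subvP => f.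
    case/memv_imgP => g; rewrite memv_cap => /andP[gsub gker] ->.
    rewrite memv_cap memv_img //= memv_ker -relabel_dlin.
    by move: gker; rewrite memv_ker => /eqP ->; rewrite linear0.
  rewrite memv_cap => /andP[/memv_imgP[g gsub ->]]; rewrite memv_ker -relabel_dlin.
  rewrite -memv_ker lker_relabel memv0 => dg.
  by apply: memv_img; rewrite memv_cap gsub memv_ker.
have bnd : (L @: (dlin Dm @: gsub gr (x.1 - dx.1, x.2 - dx.2)) =
            dlin Dm' @: gsub gr' (x'.1 - dx'.1, x'.2 - dx'.2))%VS.
  rewrite -(relabel_gsub gp) -!limg_comp; congr (_ @: _)%VS.
  by apply/lfunP => f; rewrite !comp_lfunE relabel_dlin.
by rewrite -cyc -bnd !dimL.
Qed.
End Transport.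

(** * The isomorphism *)

Fact degree_arith (a a' e e' m x r p q : nat) :
  a'%:Z - 2 * e'%:Z = a%:Z - 2 * e%:Z - 1 ->
  ((a' + m)%N%:Z - 2 * (e' + x)%N%:Z + r.+1%:Z + p%:Z - 2 * q%:Z, r.+1%:Z - q%:Z) =
  ((a + m)%N%:Z - 2 * (e + x)%N%:Z + r%:Z + p%:Z - 2 * q%:Z, r%:Z - q%:Z + 1) :> (int * int)%type.
Proof. by move=> H; congr (_, _); lia. Qed.

Fact grading_arith (a m e x r p q b y : nat) (g : int) :
  g = b%:Z - 1 - 2 * y%:Z ->
  (a + 1 + b + m)%N%:Z - 2 * (e + 1 + y + x)%N%:Z + r%:Z + p%:Z - 2 * q%:Z =
  (a + m)%N%:Z - 2 * (e + x)%N%:Z + g + p%:Z - q%:Z + 2 * (r%:Z - q%:Z) - (r%:Z - q%:Z).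
Proof. by move=> ->; lia. Qed.

Section Isomorphism.
Variables (T : tdiag) (k : bool).
Hypothesis diagT : is_tangle_diagram T.
Local Notation n := (ncr T).
Local Notation D := (dart (ncr T)).
Implicit Types (d : D) (i : state T) (c : 'I_n) (v w : {set D}).

Definition toKh0 (x : BK0 T) : BKh0 T :=
  let '(i, v, f, y) := x in (i, closeup i v (xbit y), f).
Definition ofKh0 (x : BKh0 T) : BK0 T :=
  let '(i, v, f) := x in
  (i, [set d in v | ~~ onarc i d], f, xgen k (ell i) (inr q2 \in v)).

Lemma toKh0_valid x : validK k x -> validKh k (toKh0 x).
Proof.
case: x => [[[i v] f] y] /= /andP[/(labKP i v)[satv offv] gy].
rewrite /labKh [inr q0 \in _]inE connect0 orbT andbT.
apply/saturatedP => x x'; rewrite connectC // => /orP[xx'|/and3P[lk ox ox']].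
  by rewrite !inE (satv _ _ xx') !(same_connect (adjR_csym diagT i) xx').
rewrite !inE (xbit_gen gy lk) /=.
by move: ox ox'; rewrite !onarcE // => -> ->; rewrite !orbT.
Qed.

Lemma labKhP i v : reflect
  ((forall d d', connect (adjC k i) d d' -> (d \in v) = (d' \in v)) /\ inr q0 \in v)
  (labKh k i v).
Proof. by apply: (iffP andP) => [[/saturatedP ? ?]|[? ?]]; split=> //; apply/saturatedP. Qed.

Lemma ofKh0_valid x : validKh k x -> validK k (ofKh0 x).
Proof.
case: x => [[i v] f] /= /labKhP[satv v0].
apply/andP; split; last by rewrite /xgen; case: k; case: (ell i); case: (_ \in _).
apply/labKP; split=> [x x' xx'|x]; last by rewrite !inE => /andP[_ /negbTE].
by rewrite !inE (satv _ _ (adjR_sub_adjC k xx')) (onarc_sim diagT xx').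
Qed.

Lemma toKh0K x : validK k x -> ofKh0 (toKh0 x) = x.
Proof.
case: x => [[[i v] f] y] /= /andP[/(labKP i v)[satv offv] gy].
have [_ r02 _ _ _] := arcsP diagT i.
congr (_, _, _, _).
  apply/setP => d; rewrite !inE; have [dv|dv] := boolP (d \in v); first by rewrite (offv _ dv).
  by rewrite onarcE //= negb_or; case: connect => //=; case: connect; rewrite ?andbF.
rewrite inE connect0 (adjR_csym diagT) r02 andbT /=.
have -> : inr q2 \in v = false by apply/negP => /offv; rewrite onarc_inr.
by move: gy; rewrite /xgen; case: k; case: (ell i); case: y.
Qed.

Lemma ofKh0K x : validKh k x -> toKh0 (ofKh0 x) = x.
Proof.
case: x => [[i v] f] /= /labKhP[satv v0]; congr (_, _, _).
have R x x' : connect (adjR i) x x' -> (x \in v) = (x' \in v).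
  by move=> xx'; apply: satv; apply: adjR_sub_adjC.
apply/setP => d; rewrite !inE onarcE //.
have [d0|nd0] := boolP (connect (adjR i) d (inr q0)); first by rewrite (R _ _ d0) v0 /= ?orbT.
have [d2|nd2] := boolP (connect (adjR i) d (inr q2)); last by rewrite !andbF !orbF andbT.
rewrite (R _ _ d2) !andbF /= andbT /xgen; have [lk|lk] := eqVneq (ell i) k.
  by case: k; case: (_ \in _).
have -> : inr q2 \in v by rewrite (satv (inr q2) (inr q0)) // connectC // lk !onarc_inr orbT.
by case: k.
Qed.

Definition toKh (b : BK T k) : BKh T k := exist _ (toKh0 (val b)) (toKh0_valid (valP b)).
Definition ofKh (b : BKh T k) : BK T k := exist _ (ofKh0 (val b)) (ofKh0_valid (valP b)).

Lemma toKhK : cancel toKh ofKh.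
Proof. by move=> b; apply: val_inj; rewrite /= toKh0K //; case: b. Qed.

Lemma ofKhK : cancel ofKh toKh.
Proof. by move=> b; apply: val_inj; rewrite /= ofKh0K //; case: b. Qed.

Lemma dK2_dKh b b' : dK2 b b' = dKh (toKh b) (toKh b').
Proof.
case: b => [[[[i v] f] y] ok]; case: b' => [[[[j w] g] z] ok'].
have /andP[lv gy] := ok; have /andP[lw gz] := ok'.
rewrite /dK2 /dKh /= /delta.
under eq_bigr => u _ do rewrite mulr_suml.
rewrite exchange_big /=; apply: eq_bigr => c _.
have [/andP[/eqP ic /eqP jE]|nst] := boolP (step i j c); last first.
  by rewrite /= big1 // => u _; rewrite mul0r.
rewrite /= lv lw !andbT; case: (f == g) => /=; last by rewrite big1 // => u _; rewrite mul0r.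
rewrite jE -/(upd i c) in lw gz *.
rewrite -(kcase_khcase diagT ic lv lw gy gz) -sum_natr_xor.
by apply: eq_bigr => u _; rewrite -natrM mulnb -andbA.
Qed.

Lemma delta_support i j u v f w g : u \in [:: l_b0; l_b1; l_p10; l_q01] ->
  @delta T i j u v f w g = 0.
Proof.
move=> uN; rewrite /delta big1 // => c _.
have -> : kcase i j c u v w = false; last by rewrite andbF.
have uL : [&& u != l_a0, u != l_a1, u != l_c0, u != l_c1, u != l_p01 & u != l_q10].
  by move: uN; rewrite !inE => /or4P[]/eqP->.
move: uL; case/and5P => a0 a1 c0 c1 /andP[p01 q10].
rewrite /kcase; case: (ell i);
  rewrite ?(negPf a0) ?(negPf a1) ?(negPf c0) ?(negPf c1) ?(negPf p01) ?(negPf q10) /=;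
  by repeat case: ifP.
Qed.

Lemma dK3_eq0 (b b' : BK T k) : dK3 b b' = 0.
Proof.
case: b => [[[[i v] f] y] ok]; case: b' => [[[[j w] g] z] ok'].
rewrite /dK3 /=; apply: big1 => j' _; apply: big1 => wm _; apply: big1 => gm _.
apply: big1 => u _; apply: big1 => u' _.
have [m|_] := boolP (mu3 u' u y == Some z); last by rewrite mulr0.
have : (u \in [:: l_b0; l_b1; l_p10; l_q01]) || (u' \in [:: l_b0; l_b1; l_p10; l_q01]).
  by move: m {ok}; case: u'; case: u; case: y.
by case/orP => uN; rewrite (delta_support _ _ _ _ _ _ uN) ?mulr0 !mul0r.
Qed.

Lemma dK_dKh b b' : dK b b' = dKh (toKh b) (toKh b').
Proof. by rewrite /dK dK3_eq0 addr0 dK2_dKh. Qed.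

(** Defined on all labellings, whatever the marked circle carries, so that intermediate sums run
    over a full product type. *)
Definition khterm c (x x' : BKh0 T) : bool :=
  let '(i, v, f) := x in let '(j, w, g) := x' in
  [&& step i j c, f == g &
      kh (connect (adjC k i)) (connect (adjC k j)) (dA c) (dB c) v w].

Lemma dKh_khterm (b b' : BKh T k) : dKh b b' = \sum_c (khterm c (val b) (val b'))%:R.
Proof.
case: b => [[[i v] f] ok]; case: b' => [[[j w] g] ok'].
have /andP[satw _] := ok'.
rewrite /dKh /=; apply: eq_bigr => c _; rewrite -!andbA.
by rewrite /kh -[saturated _ w]/(closed_set (adjC k j) w) satw.
Qed.

Lemma step_upd i j c : step i j c -> i c = false /\ j = upd i c.
Proof. by case/andP => /eqP ? /eqP. Qed.

(** A nonzero merge involving a circle labelled x gives x, and a split of x gives x tensor x, so the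
    marked circle keeps its label. *)
Lemma khterm_valid c x x' : khterm c x x' -> validKh k x -> validKh k x'.
Proof.
case: x => [[i v] f]; case: x' => [[j w] g] /= /and3P[st _ /and3P[satw /forallP off rule]].
case/labKhP => satv v0; rewrite /labKh; apply/andP; split; first exact: satw.
have [/step_upd[ic jE] _] := conj st I.
have [EE Eij] := cob_adjC diagT k ic; rewrite -jE in EE Eij.
have [ti|nti] := boolP (connect (adjC k i) (inr q0) (dA c) ||
                        connect (adjC k i) (inr q0) (dB c)); last first.
  by have := implyP (off (inr q0)) nti; rewrite v0 => /eqP <-.
have tj : connect (adjC k j) (inr q0) (dA c) || connect (adjC k j) (inr q0) (dB c).
  have := EE (inr q0) (dA c); rewrite /addE !connect0 /= !andbT ti orbT.
  by case: connect; case: connect.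
have vAB : (dA c \in v) || (dB c \in v).
  by case/orP: ti => /satv <-; rewrite v0 ?orbT.
have [wA wB] : (dA c \in w) /\ (dB c \in w).
  move: rule Eij; case: ifP => AB.
    have vA : dA c \in v by case/orP: vAB => //; rewrite (satv _ _ AB).
    by rewrite vA => /andP[].
  rewrite vAB => /andP[_ /eqP wA] /(saturatedP _ _ satw) wAB.
  by rewrite -wAB wA.
by move/saturatedP: satw => satw; case/orP: tj => /satw ->.
Qed.

Lemma sum_at (F0 : BKh0 T -> F) j (f : {ffun 'I_(nfree T) -> bool}) :
  (forall x, F0 x != 0 -> x.1.1 = j /\ x.2 = f) -> \sum_x F0 x = \sum_w F0 (j, w, f).
Proof.
move=> supp.
have -> : \sum_x F0 x = \sum_(p : state T * {set D}) \sum_g F0 (p, g).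
  by rewrite pair_bigA /=; apply: eq_bigr => [[]].
have -> : \sum_(p : state T * {set D}) \sum_g F0 (p, g) = \sum_(p : state T * {set D}) F0 (p, f).
  apply: eq_bigr => p _; rewrite (bigD1 f) //= big1 ?addr0 // => g /eqP gf.
  by apply/eqP; case: eqP => // /eqP /supp [].
have -> : \sum_(p : state T * {set D}) F0 (p, f) = \sum_j' \sum_w F0 (j', w, f).
  by rewrite pair_bigA /=; apply: eq_bigr => [[]].
rewrite (bigD1 j) //= [X in _ + X]big1 ?addr0 // => j' /eqP jj'; apply: big1 => w _.
by apply/eqP; case: eqP => // /eqP /supp [].
Qed.

(** Off the diagonal the terms cancel in pairs modulo 2. *)
Lemma sum_symF m (G : 'I_m -> 'I_m -> F) :
  (forall a b, G a b = G b a) -> (forall a, G a a = 0) -> \sum_a \sum_b G a b = 0.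
Proof.
elim: m G => [|m IH] G sG G0; first by rewrite big_ord0.
rewrite big_ord_recl big_ord_recl G0 add0r.
under [X in _ + X]eq_bigr => i _ do rewrite big_ord_recl sG.
by rewrite big_split /= IH // addr0 addFF.
Qed.

Definition square c c' x x'' : F := \sum_x' (khterm c x x' && khterm c' x' x'')%:R.

Lemma square_diag c x x'' : square c c x x'' = 0.
Proof.
apply: big1 => x' _; case: x => [[i v] f]; case: x' => [[j w] g]; case: x'' => [[l u] h] /=.
case: (boolP (step i j c)) => // /step_upd[_ ->].
by rewrite /step ffunE eqxx /= andbF.
Qed.

(** Both orders of changing two crossings pass through a single intermediate resolution, and
    [kh_square] compares the two composites. *)
Lemma square_sym c c' x x'' : validKh k x -> square c c' x x'' = square c' c x x''.
Proof.
have [<- //|cc'] := eqVneq c c'.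
case: x => [[i v] f]; case: x'' => [[l u] h] /labKhP[satv _].
have squareE a b : a != b -> square a b (i, v, f) (l, u, h) =
    if [&& i a == false, i b == false, l == upd (upd i a) b & f == h] then
      \sum_w (kh (connect (adjC k i)) (connect (adjC k (upd i a))) (dA a) (dB a) v w &&
        kh (connect (adjC k (upd i a))) (connect (adjC k l)) (dA b) (dB b) w u)%:R
    else 0.
  move=> ab; rewrite /square (sum_at (j := upd i a) (f := f)); last first.
    move=> [[j w] g] /=; case: (boolP (step i j a)) => [/step_upd[_ ->]|]; last by rewrite eqxx.
    by case: (f =P g) => [->|] //=; rewrite eqxx.
  rewrite /= /step -!/(upd _ _) !eqxx /= ffunE (eq_sym b a) (negPf ab) andbT.
  case: (i a == false) => /=; last by rewrite big1.
  case: (i b == false) => /=; last by rewrite big1 // => w _; rewrite andbF.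
  case: (l == _) => /=; last by rewrite big1 // => w _; rewrite andbF.
  by case: (f == h) => //=; rewrite big1 // => w _; rewrite andbF.
have updC : upd (upd i c) c' = upd (upd i c') c.
  by apply/ffunP => a; rewrite !ffunE; case: (a == c); case: (a == c').
have c'c : c' != c by rewrite eq_sym.
rewrite (squareE _ _ cc') (squareE _ _ c'c) updC andbCA.
case: ifP => // /and4P[/eqP ic' /eqP ic /eqP -> _].
have eqv j := equivr_connect (adjC_csym diagT k j).
have c1 := cob_adjC diagT k ic; have c2 := cob_adjC diagT k ic'.
have uc : upd i c c' = false by rewrite ffunE (negPf c'c).
have uc' : upd i c' c = false by rewrite ffunE (negPf cc').
have c1' := cob_adjC diagT k uc; have c2' := cob_adjC diagT k uc'; rewrite updC in c1'.
apply: (kh_square u (eqv i) (eqv (upd i c)) (eqv (upd i c')) (eqv (upd (upd i c') c)) c1 c1' c2 c2').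
exact/saturatedP.
Qed.

Lemma dKh_squared (b b'' : BKh T k) : \sum_b' dKh b b' * dKh b' b'' = 0.
Proof.
pose G (x x' : BKh0 T) : F := \sum_c (khterm c x x')%:R.
have -> : \sum_b' dKh b b' * dKh b' b'' = \sum_(x' in validKh k) G (val b) x' * G x' (val b'').
  by rewrite (big_sub (validKh k)); apply: eq_bigr => b' _; rewrite !dKh_khterm.
rewrite big_mkcond /= -[RHS](@sum_symF _ (fun c c' => square c c' (val b) (val b''))).
- rewrite /square.
  under [RHS]eq_bigr => c _ do rewrite exchange_big /=.
  rewrite [RHS]exchange_big /=; apply: eq_bigr => x' _.
  case: ifP => [_|nval].
    rewrite /G mulr_suml; apply: eq_bigr => c _; rewrite mulr_sumr; apply: eq_bigr => c' _.
    by rewrite -natrM mulnb.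
  rewrite big1 // => c _; rewrite big1 // => c' _.
  case: (boolP (khterm c (val b) x')) => // /khterm_valid /(_ (valP b)) val'.
  by case/negP: (negbT nval).
- by move=> c c'; apply/square_sym/valP.
- by move=> c; apply: square_diag.
Qed.

Lemma card_upd i c : i c = false -> #|[pred a | upd i c a]| = #|[pred a | i a]|.+1.
Proof.
move=> ic; rewrite (cardD1 c) !inE ffunE eqxx add1n; congr _.+1.
by apply: eq_card => a; rewrite !inE ffunE; have [->|] := eqVneq a c; rewrite ?ic.
Qed.

Lemma dKh_degree (b b' : BKh T k) : dKh b b' != 0 ->
  gradKh b' = ((gradKh b).1, (gradKh b).2 + 1).
Proof.
rewrite dKh_khterm => nz.
have [c kc] : exists c, khterm c (val b) (val b').
  apply/existsP; apply: contraNT nz => /existsPn no; apply/eqP; apply: big1 => c _.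
  by rewrite (negPf (no c)).
rewrite /gradKh; have := valP b; case: (val b) kc => [[i v] f]; case: (val b') => [[j w] g].
move=> /= /and3P[/step_upd[ic ->] /eqP <- khw] /labKhP[satv _].
have := kh_degree (adjC_csym diagT k i) (adjC_csym diagT k (upd i c)) (cob_adjC diagT k ic)
  (introT (saturatedP _ _) satv) khw.
rewrite card_upd //; exact: degree_arith.
Qed.

(** A word for [v] becomes a word for the closed labelling by adding the letter [q0], and also [q2]
    when the second arc closes to its own circle labelled x. *)
Lemma n_comp_closeup i v (x : bool) : labK i v -> (ell i != k -> x) ->
  n_comp (adjC k i) (closeup i v x) = (n_comp (adjR i) v + 1 + ((ell i == k) && x))%N.
Proof.
move=> /(labKP i v)[satv offv] lx; have [_ r02 _ _ _] := arcsP diagT i.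
have Rs := adjR_csym diagT i; have Cs := adjC_csym diagT k i.
have eqR := equivr_connect Rs; have eqC := equivr_connect Cs.
have /(saturated_word eqR)[s oks vE] : saturated (connect (adjR i)) v by apply/saturatedP.
have offs z : z \in s -> onarc i z = false.
  by move=> zs; apply: offv; rewrite -vE inE; apply/hasP; exists z; rewrite ?connect0.
have CR d z : z \in s -> connect (adjC k i) d z = connect (adjR i) d z.
  by move=> /offs oz; rewrite connectC // oz !andbF orbF.
have clCR : cl (connect (adjC k i)) s = v.
  by rewrite -vE; apply/setP => d; rewrite !inE; apply: eq_in_has => z /CR ->.
have okC : okw (connect (adjC k i)) s.
  suff okE t : {subset t <= s} -> okw (connect (adjC k i)) t = okw (connect (adjR i)) t.
    by rewrite okE.
  elim: t => //= a t IH sub; rewrite /okw /= -!/(okw _ _) IH; last first.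
    by move=> z zt; apply: sub; rewrite inE zt orbT.
  congr (_ && _); apply: eq_in_all => z zt; rewrite CR //.
  by apply: sub; rewrite inE zt orbT.
have onN b : inr b \in v = false by apply/negP => /offv; rewrite onarc_inr.
have -> : n_comp (adjR i) v = size s by rewrite -vE n_comp_cl.
pose s' := if (ell i == k) && x then inr q0 :: inr q2 :: s else inr q0 :: s.
have -> : closeup i v x = cl (connect (adjC k i)) s'.
  rewrite /s'; apply/setP => d; rewrite inE.
  case: (eqVneq (ell i) k) lx => lk lx; last first.
    by rewrite in_cl_cons clCR connectC // lk onarc_inr andbT lx //= onarcE //;
      case: (d \in v); case: connect; case: connect.
  by case: (x) => /=; rewrite !in_cl_cons clCR !connectC // lk eqxx /= ?orbF;
    case: (d \in v); case: connect => //=; case: connect.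
rewrite n_comp_cl //; first by rewrite /s'; case: ifP => _ /=; rewrite ?addn0 ?addn1 // addn1.
rewrite /s'; case: ifP => [/andP[/eqP lk _]|_]; rewrite !okw_cons ?in_cl_cons clCR !onN okC //.
by rewrite connectC // r02 lk eqxx.
Qed.

Lemma gradKh_toKh (b : BK T k) :
  gradKh (toKh b) = ((bidegK b).1 - (bidegK b).2, (bidegK b).2).
Proof.
case: b => [[[[i v] f] y] ok]; have /andP[lv gy] := ok.
rewrite /gradKh /bidegK /= /hdeg.
have offl : labK i [set d | ~~ onarc i d].
  apply/labKP; split=> [d d' dd'|d]; rewrite !inE ?(onarc_sim diagT dd') //.
  by move/negbTE.
have -> : n_comp (adjC k i) predT = (n_comp (adjR i) [pred d | ~~ onarc i d] + 1 + (ell i == k))%N.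
  (* All circles are counted as those labelled x in the labelling that puts x everywhere. *)
  have -> : n_comp (adjC k i) predT = n_comp (adjC k i) (closeup i [set d | ~~ onarc i d] true).
    apply: eq_card => d; rewrite !inE onarcE //; congr (_ && _).
    by case: connect => //=; case: connect.
  rewrite n_comp_closeup // andbT; congr (_ + _ + _)%N.
  by apply: eq_card => d; rewrite !inE.
rewrite n_comp_closeup //; last exact: xbit_gen gy.
congr (_, _).
(* The grading of a generator is -1 for the marked circle plus, when the arcs close separately, 1 or
   -1 for the second circle. *)
have gyE : pgen y = (ell i == k)%:Z - 1 - 2 * ((ell i == k) && xbit y)%:Z.
  by move: gy; clear; case: k; case: (ell i); case: y.
apply: (grading_arith _ _ _ _ _ _ _ gyE).
Qed.
End Isomorphism.

Theorem theorem9p4 (T : tdiag) (k : bool) :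
  is_tangle_diagram T -> oriented T -> orient_extends T k ->
  (* d^2 = 0 *)
  (forall b b'' : BK T k, \sum_(b' : BK T k) dK b b' * dK b' b'' = 0) /\
  (* bidegree (1,1) *)
  (forall b b' : BK T k, dK b b' != 0 ->
     bidegK b' = ((bidegK b).1 + 1, (bidegK b).2 + 1)) /\
  (* all mu^3 terms vanish: d consists only of the mu^2 terms *)
  (forall b b' : BK T k, dK3 b b' = 0) /\
  (* a bigraded chain isomorphism K_{T,k} -> CKh^red([T,k]), (r,s) |-> (r-s,s) *)
  (exists (Phi : BK T k -> BKh T k -> F) (Psi : BKh T k -> BK T k -> F),
     (forall b b' : BK T k, \sum_(c : BKh T k) Phi b c * Psi c b' = (b == b')%:R) /\
     (forall c c' : BKh T k, \sum_(b : BK T k) Psi c b * Phi b c' = (c == c')%:R) /\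
     (forall (b : BK T k) (c : BKh T k),
        \sum_(b' : BK T k) dK b b' * Phi b' c = \sum_(c' : BKh T k) Phi b c' * dKh c' c) /\
     (forall (b : BK T k) (c : BKh T k), Phi b c != 0 ->
        gradKh c = ((bidegK b).1 - (bidegK b).2, (bidegK b).2))) /\
  (* H^{r,s}(K_{T,k}) = Kh^red([T,k])^{r-s,s} (as F_2-vector spaces: equal dimension) *)
  (forall r s : int,
     homdim (@dK T k) (@bidegK T k) (r, s) (1, 1) =
     homdim (@dKh T k) (@gradKh T k) (r - s, s) (0, 1)).
Proof.
move=> diagT _ _.
have toK := toKhK diagT (k := k); have ofK := ofKhK diagT (k := k).
have dE := dK_dKh diagT (k := k); have grE := gradKh_toKh diagT (k := k).
have grP (b : BK T k) (r s : int) : (bidegK b == (r, s)) = (gradKh (toKh diagT b) == (r - s, s)).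
  rewrite grE; case: (bidegK b) => r' s'; rewrite !xpair_eqE /=.
  by have [->|] := eqVneq s' s; rewrite ?andbF // !andbT (inj_eq (addIr _)).
split; last split; last split; last split.
- move=> b b''; rewrite (reindex (ofKh diagT (k := k))) /=; last first.
    by exists (toKh diagT (k := k)) => x _.
  by under eq_bigr => c _ do rewrite !dE ofK; apply: dKh_squared.
- move=> b b'; rewrite dE => /(dKh_degree diagT); rewrite !grE.
  case: (bidegK b) (bidegK b') => r s [r' s'] /= [] rE sE; congr (_, _) => //.
  by move: rE; rewrite sE; lia.
- exact: dK3_eq0.
- exists (fun b c => (toKh diagT b == c)%:R), (fun c b => (toKh diagT b == c)%:R).
  have sum_eq (I : finType) (i : I) (G : I -> F) : \sum_j (i == j)%:R * G j = G i.
    rewrite (bigD1 i) //= eqxx mul1r big1 ?addr0 // => j ji.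
    by rewrite eq_sym (negPf ji) mul0r.
  split; last split; last split.
  + by move=> b b'; rewrite sum_eq eq_sym (can_eq toK).
  + move=> c c'; rewrite -{1}(ofK c).
    under eq_bigr => b _ do rewrite (can_eq toK) eq_sym.
    by rewrite sum_eq ofK.
  + move=> b c; rewrite sum_eq (bigD1 (ofKh diagT c)) //= ofK eqxx mulr1 dE ofK big1 ?addr0 // => b' b'c.
    by rewrite -{1}(ofK c) (can_eq toK) (negPf b'c) mulr0.
  + move=> b c; case: (toKh diagT b =P c) => [<- _|]; last by rewrite eqxx.
    exact: grE.
- move=> r s; apply: (homdim_relabel toK ofK dE) => b; rewrite /= ?grP //.
  (* The preceding bidegree (r-1, s-1) goes to (r-s, s-1), so the step (1,1) becomes (0,1). *)
  by rewrite subr0 opprB addrA subrK.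
Qed.
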